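(* Let $\mathscr X=G/K$ be the homogeneous space of a compact group $G$ ($K$ a closed subgroup), let $T$ be a $G$-invariant random field with finite variance on $\mathscr X$, and let $\sigma_1,\sigma_2\in\widehat G$. (a) If $\sigma_1$ and $\sigma_2$ are not equivalent then, for every choice of orthonormal bases of $H^{\sigma_1}$ and $H^{\sigma_2}$, the random variables $\widehat T(\sigma_1)_{ij}$ and $\widehat T(\sigma_2)_{k\ell}$ are orthogonal, $1\le i,j\le\dim\sigma_1$, $1\le k,\ell\le\dim\sigma_2$. (b) If $\sigma_1=\sigma_2=\sigma$, let $\Gamma(\sigma)=\mathrm E[\widehat T(\sigma)\widehat T(\sigma)^*]$. Then $$\mathrm{Cov}\bigl(\widehat T(\sigma)_{ij},\widehat T(\sigma)_{k\ell}\bigr)=\delta_{j\ell}\,\Gamma(\sigma)_{ik}.$$ In particular, coefficients belonging to different columns are orthogonal, and the covariance between entries in different rows of a same column does not depend on the column.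
   Context: $dg$ is the normalized Haar measure of $G$ and $dx$ the normalized $G$-invariant measure on $\mathscr X$. $\widehat G$ is the set of equivalence classes of irreducible representations of $G$; for each $\sigma\in\widehat G$ a unitary Hilbert $G$-module $H^\sigma$ of class $\sigma$ is fixed, and $\sigma(g)$ denotes the action of $g$ on it. A (real or complex) random field $T$ on $\mathscr X$ is a family $(T(x))_{x\in\mathscr X}$ of random variables on a probability space such that $(x,\omega)\mapsto T(x,\omega)$ is jointly measurable. It has finite variance if $\mathrm E\bigl(\int_{\mathscr X}|T(x)|^2dx\bigr)<\infty$ (so $T\in L^2(\mathscr X)$ a.s.). It is $G$-invariant if for every $g\in G$ and $x_1,\dots,x_m\in\mathscr X$ the vectors $(T(x_1),\dots,T(x_m))$ and $(T(gx_1),\dots,T(gx_m))$ have the same law. $T$ is regarded as a random field on $G$ via $T(g):=T(gx_0)$, where $x_0\in\mathscr X$ is a fixed point with isotropy group $K$. The Fourier coefficient is the $\mathrm{End}(H^\sigma)$-valued random variable $$\widehat T(\sigma)=\sqrt{\dim\sigma}\int_GT(g)\,\sigma(g^{-1})\,dg .$$ $\widehat T(\sigma)_{ij}$ and $\Gamma(\sigma)_{ik}$ denote matrix entries with respect to an orthonormal basis of $H^\sigma$, and $\widehat T(\sigma)^*$ is the adjoint. Two complex square-integrable random variables $Z,W$ are orthogonal if $\mathrm E[Z\overline W]=0$; $\mathrm{Cov}(Z,W)=\mathrm E[(Z-\mathrm E Z)\overline{(W-\mathrm E W)}]$ is their covariance; $\delta_{j\ell}$ is the Kronecker symbol.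
   Formalization: In (b) the covariance is δ_{jℓ}Γ(σ)_{ik}/dim σ (the printed formula lacks the factor 1/dim σ), stated for σ nontrivial or E T(x)=0 for all x, since it fails for trivial σ with nonzero mean; the uncentred moment identity and both ''in particular'' claims hold for every σ. *)

(* Defs.v *)
From HB Require Import structures.
From mathcomp Require Import all_boot all_order all_algebra generic_quotient.
From mathcomp Require Import sesquilinear.
From mathcomp Require Import all_classical all_reals all_analysis.
From mathcomp.real_closed Require Import complex.

Set Implicit Arguments.
Unset Strict Implicit.
Unset Printing Implicit Defensive.

Import Order.TTheory GRing.Theory Num.Theory.
Import numFieldNormedType.Exports.

Local Open Scope classical_set_scope.
Local Open Scope complex_scope.
Local Open Scope ring_scope.

(** * Topological groups and their homogeneous spaces *)

HB.mixin Record isTopologicalGroup G of PointedTopological G & Group G := {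
  mulg_continuous : continuous (fun p : G * G => (p.1 * p.2)%g) ;
  invg_continuous : continuous (fun g : G => (g^-1)%g)
}.

(* The base point is arbitrary: it is only there because a [measurableType]
   has to be pointed. *)
#[short(type="topologicalGroupType")]
HB.structure Definition TopologicalGroup :=
  {G of PointedTopological G & Group G & isTopologicalGroup G}.

Section LeftCosets.
Context (G : topologicalGroupType) (K : groupClosed G).

Definition lcoset_rel : rel G := fun g h => (g^-1 * h)%g \in K.

Lemma lcoset_rel_equiv : equiv_class_of lcoset_rel.
Proof.
split=> [g|g h|h g k]; rewrite /lcoset_rel.
- by rewrite mulVg gpred1.
- by rewrite -[RHS]gpredV invgM invgK.
- move=> Kgh Khk; rewrite -[k](mulVKg h) mulgA; exact: gpredM.
Qed.

Canonical lcoset_equiv := EquivRelPack lcoset_rel_equiv.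

(* [G / K], with the quotient topology *)
Definition lcosets := quotient_topology {eq_quot lcoset_equiv}%qT.

(* [g . hK := (g h) K] *)
Definition lcoset_act (g : G) (x : lcosets) : lcosets :=
  (\pi_lcosets (g * repr x)%g)%qT.

End LeftCosets.

(** * Borel probability measures *)

Definition borel (X : ptopologicalType) := g_sigma_algebraType (@open X).

Section InvariantMeasures.
Context (R : realType).

(* For a finite measure on a compact Hausdorff space, this is the Radon
   property; outer regularity follows by taking complements. *)
Definition inner_regular (X : ptopologicalType)
    (mu : {measure set (borel X) -> \bar R}) :=
  forall A : set (borel X), measurable A ->
    mu A = ereal_sup [set mu C | C in [set C : set X | compact C /\ C `<=` A]].

Definition is_haar (G : topologicalGroupType) (mu : probability (borel G) R) :=
  inner_regular mu /\
  forall (g : G) (A : set (borel G)), measurable A ->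
    mu ((fun h : G => (g * h)%g) @^-1` A) = mu A.

Definition is_invariant (G : topologicalGroupType) (K : groupClosed G)
    (mu : probability (borel (lcosets K)) R) :=
  inner_regular mu /\
  forall (g : G) (A : set (borel (lcosets K))), measurable A ->
    mu (lcoset_act g @^-1` A) = mu A.

End InvariantMeasures.

(** * Integration of complex and vector valued functions *)

Section ComplexIntegral.
Context (R : realType) d (X : measurableType d).
Implicit Types (mu : {measure set X -> \bar R}) (f : X -> R[i]).

Definition reim (z : R[i]) : R * R := (complex.Re z, complex.Im z).

Definition cmeasurable f := measurable_fun [set: X] (reim \o f).

Definition sqmod (z : R[i]) : R := complex.Re z ^+ 2 + complex.Im z ^+ 2.

Definition cintegral mu f : R[i] :=
  Rintegral mu [set: X] (fun x => complex.Re (f x)) +i*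
  Rintegral mu [set: X] (fun x => complex.Im (f x)).

(* The integral in a finite-dimensional space is taken coordinatewise; for an
   integrable function the result does not depend on the basis. *)
Definition vintegral (V : vectType R[i]) mu (f : X -> V) : V :=
  \sum_(i < \dim (fullv : {vspace V}))
    cintegral mu (fun x => coord (vbasis fullv) i (f x)) *: (vbasis fullv)`_i.

End ComplexIntegral.

(** * Complex random variables *)

Section ComplexRandomVariables.
Context (R : realType) d (W : measurableType d) (P : probability W R).
Implicit Types Z : W -> R[i].

Definition square_integrable Z :=
  cmeasurable Z /\ (\int[P]_w (sqmod (Z w))%:E < +oo)%E.

Definition expect Z : R[i] := cintegral P Z.

Definition orthogonal_rv Z1 Z2 :=
  [/\ square_integrable Z1, square_integrable Z2 &
      expect (fun w => Z1 w * ((Z2 w)^*)%R) = 0].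

Definition cov Z1 Z2 : R[i] :=
  expect (fun w => (Z1 w - expect Z1) * ((Z2 w - expect Z2)^*)%R).

End ComplexRandomVariables.

(** * Unitary modules *)

(* Finite-dimensional unitary Hilbert [G]-modules.  The form is linear in its
   first argument, and the action is strongly continuous. *)
Record unitary_module (R : realType) (G : topologicalGroupType) := {
  um_space :> vectType R[i] ;
  um_form : {dot um_space for (@Num.conj R[i])} ;
  um_act : G -> 'End(um_space) ;
  um_act1 : um_act 1%g = \1%VF ;
  um_actM : forall g h, um_act (g * h)%g = (um_act g \o um_act h)%VF ;
  um_unitary : forall g u v,
    um_form (um_act g u) (um_act g v) = um_form u v ;
  um_continuous : forall (v : um_space) (g0 : G),
    (fun g => let u := um_act g v - um_act g0 v in
              complex.Re (um_form u u) : R) g @[g --> g0] --> (0 : R)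
}.

Section UnitaryModules.
Context (R : realType) (G : topologicalGroupType).
Implicit Types S : unitary_module R G.

Definition um_dim S := \dim (fullv : {vspace S}).

Definition um_irreducible S :=
  (0 < um_dim S)%N /\
  forall U : {vspace S}, (forall g, (um_act S g @: U <= U)%VS) ->
    U = 0%VS \/ U = fullv.

Definition um_equivalent S1 S2 :=
  exists2 phi : 'Hom(S1, S2), bijective phi &
    forall g, (phi \o um_act S1 g)%VF = (um_act S2 g \o phi)%VF.

Definition um_trivial S := forall g, um_act S g = \1%VF.

Definition orthonormal_basis S (e : (um_dim S).-tuple S) :=
  basis_of fullv e /\ orthonormal (um_form S) e.

(* [A_ij = <A e_j, e_i>] *)
Definition entry S (e : (um_dim S).-tuple S) (A : 'End(S))
    (i j : 'I_(um_dim S)) : R[i] :=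
  um_form S (A (tnth e j)) (tnth e i).

Definition adjoint S (A : 'End(S)) : 'End(S) :=
  xget 0 [set B : 'End(S) |
    forall u v, um_form S (A u) v = um_form S u (B v)].

End UnitaryModules.

(** * Random fields on [G / K] and their Fourier coefficients *)

Section RandomFields.
Context (R : realType) (G : topologicalGroupType) (K : groupClosed G).
Context d (W : measurableType d) (P : probability W R).
Implicit Types (T : lcosets K -> W -> R[i]) (S : unitary_module R G).

(* Complex valued fields; the real ones are those with values in [R]. *)
Definition random_field T :=
  cmeasurable (fun p : borel (lcosets K) * W => T p.1 p.2).

Definition finite_variance (dx : probability (borel (lcosets K)) R) T :=
  (\int[P]_w \int[dx]_x (sqmod (T x w))%:E < +oo)%E.

Definition invariant_field T :=
  forall (g : G) (m : nat) (x : 'I_m -> lcosets K)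
         (B : set (m.-tuple (R * R))), measurable B ->
    P ((fun w => [tuple reim (T (x i) w) | i < m]) @^-1` B) =
    P ((fun w => [tuple reim (T (lcoset_act g (x i)) w) | i < m]) @^-1` B).

(* [x0] is the point through which [T] is lifted to [G]. *)
Definition fourier (dg : probability (borel G) R) (x0 : lcosets K) T S (w : W) :
    'End(S) :=
  (Num.sqrt ((um_dim S)%:R : R))%:C *:
    vintegral dg (fun g : borel G =>
      T (lcoset_act (g : G) x0) w *: um_act S (g : G)^-1%g).

(* [E[That That^* ]].  Since [(That That^* )_ik = \sum_m That_im (That_km)^*] sums
   over the [um_dim S] columns, a covariance [c_ik] common to all the columns
   is [Gamma_ik / um_dim S], not [Gamma_ik]. *)
Definition fourier_Gamma (dg : probability (borel G) R) (x0 : lcosets K) T S :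
    'End(S) :=
  vintegral P (fun w =>
    (fourier dg x0 T S w \o adjoint (fourier dg x0 T S w))%VF).

End RandomFields.

(* Main.v *)
Require Import Defs.
From HB Require Import structures.
From mathcomp Require Import all_boot all_order all_algebra generic_quotient.
From mathcomp Require Import sesquilinear.
From mathcomp Require Import all_classical all_reals all_analysis.
From mathcomp Require Import measurable_realfun.
From mathcomp Require Import ring lra.
From mathcomp.real_closed Require Import complex.

(** A translation of the field multiplies its Fourier coefficient on the right
    by a unitary operator, and it does not change the law of the field.  So for
    fixed vectors [a] and [b] the pairing
<<
      B (u, v) = E [ <That(s1) u, a> * conj <That(s2) v, b> ]
>>
    satisfies [B (s1(g) u, s2(g) v) = B (u, v)]
    ([fourier_pairing_invariant]).  A sesquilinear pairing is given by a linear
    map, which is here an intertwiner, and Schur's lemma applies: [B] vanishes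
    when the modules are not equivalent ([invariant_pairing0]), and it is a
    multiple [c] of the inner product when they coincide
    ([invariant_pairing_scalar]).  Taking [u], [v], [a], [b] in orthonormal bases
    gives the orthogonality relations.  The trace over the columns identifies
    the constant, since the entry [(a, b)] of [Gamma] is the sum of
    [B (e_m, e_m)] over [m], that is [c] times the dimension
    ([entry_fourier_Gamma]).  In the same way [E <That(s) u, a>] is an invariant
    linear functional of [u], which is zero on a nontrivial irreducible module
    ([expect_fourier_nontrivial]), so that covariances are plain second moments
    there.  A trivial irreducible module has dimension one, and for it nothing
    remains to be compared between different rows.

    Most of the work is analytic.  By invariance and transitivity all the values
    of the field have the same second moment, which is finite because its
    average over [dx] is ([second_moment_bounded]).  For almost every sample the
    path is therefore square integrable on the group, and there
    [<That(s) u, a>] is the average of the path against a bounded matrix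
    coefficient ([fourier_mean]).  Two exchanges of expectation and integral
    express the second moments of such averages by the covariance kernel
    ([expect_mean_pair]), which is invariant under simultaneous translation;
    the Haar measure then absorbs the translation in each variable
    ([expect_mean_pair_translate]).  Each translation is by one fixed element of
    the group, because for a compact group that is not second countable the
    multiplication need not be measurable on the product of the Borel
    sigma-algebras. *)

Set Implicit Arguments.
Unset Strict Implicit.
Unset Printing Implicit Defensive.

Import Order.TTheory GRing.Theory Num.Theory.
Import numFieldNormedType.Exports.

Local Open Scope classical_set_scope.
Local Open Scope complex_scope.
Local Open Scope ring_scope.

(** * Unitary modules and Schur's lemma *)

Section OrthonormalBasis.
Context (R : realType) (G : topologicalGroupType) (S : unitary_module R G).
Context (e : (um_dim S).-tuple S) (onb_e : orthonormal_basis e).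
Local Notation form := (um_form S).
Implicit Types (u v : S) (A : 'End(S)).

Lemma form_conj u v : form u v = (form v u)^*.
Proof. by rewrite hermC expr0 mul1r. Qed.

Lemma onb_form i j : form (tnth e i) (tnth e j) = (i == j)%:R.
Proof.
case: onb_e => be /orthonormalP[ue oe].
by rewrite oe ?mem_tnth// (tnth_nth 0) (tnth_nth 0) nth_uniq ?size_tuple.
Qed.

Lemma onb_expand v : v = \sum_j form v (tnth e j) *: tnth e j.
Proof.
case: onb_e => be _.
have ve : v \in <<e>>%VS by rewrite (span_basis be) memvf.
rewrite [in LHS](coord_span ve).
apply: eq_bigr => j _; rewrite -tnth_nth; congr (_ *: _).
rewrite [v in RHS](coord_span ve) linear_sumlz (bigD1 j)//= -tnth_nth.
rewrite linearZl_LR/= onb_form eqxx mulr1 big1 ?addr0// => i ij.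
by rewrite -tnth_nth linearZl_LR/= onb_form (negbTE ij) mulr0.
Qed.

End OrthonormalBasis.

Section Schur.
Context (R : realType) (G : topologicalGroupType).
Implicit Types S : unitary_module R G.

Lemma form_actl S g u v :
  um_form S (um_act S g u) v = um_form S u (um_act S g^-1%g v).
Proof.
rewrite -[RHS](um_unitary g).
have := @um_actM _ _ S g g^-1%g; rewrite mulgV um_act1.
move=> /(congr1 (fun f : 'End(S) => f v)).
by rewrite lfunE/= comp_lfunE => <-.
Qed.

(** The kernel and the image of an intertwiner are invariant subspaces, so each
    of them is zero or everything. *)
Lemma intertwiner_equivalent S1 S2 (A : 'Hom(S1, S2)) :
  um_irreducible S1 -> um_irreducible S2 ->
  (forall g, (A \o um_act S1 g)%VF = (um_act S2 g \o A)%VF) ->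
  A != 0 -> um_equivalent S1 S2.
Proof.
move=> [_ irr1] [_ irr2] comA nzA.
have cA g u : A (um_act S1 g u) = um_act S2 g (A u).
  by rewrite -comp_lfunE comA comp_lfunE.
have kerA : lker A = 0%VS.
  have [|//|kerT] := irr1 (lker A) _.
    move=> g; apply/subvP => _ /memv_imgP[u uker ->].
    by move: uker; rewrite !memv_ker cA => /eqP ->; rewrite linear0.
  case/eqP: nzA; apply/lfunP => u; rewrite lfunE/=; apply/eqP.
  by rewrite -memv_ker kerT memvf.
have imA : limg A = fullv.
  have [|im0|//] := irr2 (limg A) _.
    move=> g; apply/subvP => _ /memv_imgP[_ /memv_imgP[u _ ->] ->].
    by rewrite -cA memv_img ?memvf.
  case/eqP: nzA; apply/lfunP => u; rewrite lfunE/=; apply/eqP.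
  by rewrite -memv0 -im0 memv_img ?memvf.
exists A; last exact: comA.
apply: (Bijective (g := (A^-1)%VF)) => u.
  by rewrite lker0_lfunK// kerA.
by rewrite limg_lfunVK// imA memvf.
Qed.

(** An eigenspace of [A] is a nonzero invariant subspace; there is one because
    the complex numbers are algebraically closed. *)
Lemma schur_scalar S (A : 'End(S)) :
  um_irreducible S ->
  (forall g, (A \o um_act S g)%VF = (um_act S g \o A)%VF) ->
  exists a, A = a *: \1%VF.
Proof.
move=> irrS comA; have [dimS irr] := irrS.
pose M := passmx.mxof (vbasis fullv) (vbasis fullv) A.
have /closed_rootP[a] : size (char_poly M) != 1%N.
  by rewrite size_char_poly eqSS -lt0n.
rewrite -eigenvalue_root_char => ea; exists a.
have bS := vbasisP (fullv : {vspace S}).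
have : passmx.leigenspace A a != 0%VS.
  by rewrite (passmx.leigenspaceE bS) (passmx.vsof_eq0 bS).
rewrite /passmx.leigenspace => eigN0.
have kE u : (u \in lker (A - a *: \1%VF)) = (A u == a *: u).
  by rewrite memv_ker add_lfunE opp_lfunE scale_lfunE id_lfunE subr_eq0.
have [|k0|kT] := irr (lker (A - a *: \1%VF)).
- move=> g; apply/subvP => _ /memv_imgP[u uker ->]; move: uker.
  by rewrite !kE -comp_lfunE comA comp_lfunE => /eqP ->; rewrite linearZ.
- by rewrite k0 eqxx in eigN0.
- apply/lfunP => u; apply/eqP.
  by rewrite scale_lfunE id_lfunE -kE kT memvf.
Qed.

(** A sesquilinear pairing is [<A u, v>] for a unique linear [A], so Schur's
    lemma for intertwiners becomes a statement about invariant pairings. *)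
Lemma invariant_pairing_hom S1 S2 (B : S1 -> S2 -> R[i])
    (e : (um_dim S2).-tuple S2) : orthonormal_basis e ->
  (forall v a u u', B (a *: u + u') v = a * B u v + B u' v) ->
  (forall u a v v', B u (a *: v + v') = a^* * B u v + B u v') ->
  (forall g u v, B (um_act S1 g u) (um_act S2 g v) = B u v) ->
  exists2 A : 'Hom(S1, S2), forall u v, um_form S2 (A u) v = B u v &
    forall g, (A \o um_act S1 g)%VF = (um_act S2 g \o A)%VF.
Proof.
move=> onb_e linB slinB invB.
pose Af u := \sum_l B u (tnth e l) *: tnth e l.
have Af_linear : linear Af.
  move=> a u u'; rewrite /Af scaler_sumr -big_split/=; apply: eq_bigr => l _.
  by rewrite linB scalerDl scalerA.
pose AL := GRing.isLinear.Build _ _ _ _ Af Af_linear.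
pose Al : {linear S1 -> S2} := HB.pack Af AL.
have AE u v : um_form S2 (linfun Al u) v = B u v.
  have B0 w : B w 0 = 0.
    have := slinB w 1 0 0; rewrite scaler0 addr0 rmorph1 mul1r.
    by move=> /eqP; rewrite addrC -subr_eq subrr => /eqP.
  have sumB (I : finType) (c : I -> R[i]) (f : I -> S2) :
      B u (\sum_k c k *: f k) = \sum_k (c k)^* * B u (f k).
    by elim/big_rec2: _ => // k x y _ <-; rewrite slinB.
  rewrite [v in RHS](onb_expand onb_e) sumB lfunE/= /Af linear_sumlz.
  apply: eq_bigr => l _; rewrite linearZl_LR/= mulrC; congr (_ * _).
  exact: form_conj.
exists (linfun Al) => // g.
have sep (x y : S2) : (forall v, um_form S2 x v = um_form S2 y v) -> x = y.
  move=> xy; apply/eqP; rewrite -subr_eq0 -(dnorm_eq0 (um_form S2)).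
  by rewrite linearBl /= subr_eq0; apply/eqP; exact: xy.
apply/lfunP => u; rewrite !comp_lfunE; apply: sep => v.
rewrite form_actl !AE -(invB g u); congr (B _ _).
by rewrite -comp_lfunE -um_actM mulgV um_act1 lfunE.
Qed.

Lemma invariant_pairing0 S1 S2 (B : S1 -> S2 -> R[i])
    (e : (um_dim S2).-tuple S2) : orthonormal_basis e ->
  um_irreducible S1 -> um_irreducible S2 -> ~ um_equivalent S1 S2 ->
  (forall v a u u', B (a *: u + u') v = a * B u v + B u' v) ->
  (forall u a v v', B u (a *: v + v') = a^* * B u v + B u v') ->
  (forall g u v, B (um_act S1 g u) (um_act S2 g v) = B u v) ->
  forall u v, B u v = 0.
Proof.
move=> onb_e irr1 irr2 neq linB slinB invB u v.
have [A AE comA] := invariant_pairing_hom onb_e linB slinB invB.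
rewrite -AE; have [->|A0] := eqVneq A 0; first by rewrite lfunE/= linear0l.
by case: neq; exact: intertwiner_equivalent comA A0.
Qed.

Lemma invariant_pairing_scalar S (B : S -> S -> R[i])
    (e : (um_dim S).-tuple S) : orthonormal_basis e -> um_irreducible S ->
  (forall v a u u', B (a *: u + u') v = a * B u v + B u' v) ->
  (forall u a v v', B u (a *: v + v') = a^* * B u v + B u v') ->
  (forall g u v, B (um_act S g u) (um_act S g v) = B u v) ->
  exists c, forall u v, B u v = c * um_form S u v.
Proof.
move=> onb_e irrS linB slinB invB.
have [A AE comA] := invariant_pairing_hom onb_e linB slinB invB.
have [a Aa] := schur_scalar irrS comA; exists a => u v.
by rewrite -AE Aa scale_lfunE id_lfunE linearZl_LR.
Qed.

(** The Riesz vector of an invariant functional is fixed by the group, hence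
    spans an invariant subspace, which irreducibility forces to be a trivial
    module. *)
Lemma invariant_functional0 S (f : S -> R[i])
    (e : (um_dim S).-tuple S) : orthonormal_basis e ->
  um_irreducible S -> ~ um_trivial S ->
  (forall a u u', f (a *: u + u') = a * f u + f u') ->
  (forall g u, f (um_act S g u) = f u) ->
  forall u, f u = 0.
Proof.
move=> onb_e [_ irr] ntriv linf invf.
have f0 : f 0 = 0.
  have := linf 1 0 0; rewrite scaler0 addr0 mul1r.
  by move=> /eqP; rewrite addrC -subr_eq subrr => /eqP.
have sumf (I : finType) (c : I -> R[i]) (h : I -> S) :
    f (\sum_k c k *: h k) = \sum_k c k * f (h k).
  by elim/big_rec2: _ => // k x y _ <-; rewrite linf.
pose z := \sum_l (f (tnth e l))^* *: tnth e l.
have fz u : f u = um_form S u z.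
  rewrite [u in LHS](onb_expand onb_e) sumf /z linear_sumr.
  apply: eq_bigr => l _; rewrite linearZr_LR/= mulrC; congr (_ * _).
  by rewrite conjCK.
have gz g : um_act S g z = z.
  apply/eqP; rewrite -subr_eq0 -(dnorm_eq0 (um_form S)) linearBr/=.
  by rewrite -fz -[f _](invf g^-1%g) fz form_actl invgK subrr.
have [|z0|zT] := irr <[z]>%VS.
- move=> g; apply/subvP => _ /memv_imgP[_ /vlineP[a ->] ->].
  by rewrite linearZ/= gz memvZ// memv_line.
- move=> u; rewrite fz; have : z \in <[z]>%VS by exact: memv_line.
  by rewrite z0 memv0 => /eqP ->; rewrite linear0r.
- case: ntriv => g; apply/lfunP => u; rewrite lfunE/=.
  have : u \in <[z]>%VS by rewrite zT memvf.
  by move=> /vlineP[a ->]; rewrite linearZ/= gz.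
Qed.

Lemma trivial_irreducible_dim1 S :
  um_irreducible S -> um_trivial S -> um_dim S = 1%N.
Proof.
move=> [dimS irr] triv.
have : vpick (fullv : {vspace S}) != 0.
  by rewrite vpick0 -dimv_eq0 -lt0n.
set z := vpick _ => z0.
have [|/eqP|zT] := irr <[z]>%VS.
- by move=> g; apply/subvP => _ /memv_imgP[v vz ->]; rewrite triv lfunE.
- by rewrite -dimv_eq0 dim_vline z0.
- by rewrite /um_dim -zT dim_vline z0.
Qed.

End Schur.

Section Entries.
Context (R : realType) (G : topologicalGroupType) (S : unitary_module R G).
Context (e : (um_dim S).-tuple S) (onb_e : orthonormal_basis e).
Implicit Types A : 'End(S).

Lemma form_functional (u v : S) : exists f : {scalar 'End(S)},
  forall A : 'End(S), f A = um_form S (A u) v.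
Proof.
pose f (A : 'End(S)) : R[i] := um_form S (A u) v.
have f_scalar : scalar f.
  by move=> a A B; rewrite /f add_lfunE scale_lfunE linearDl linearZl_LR.
pose fL := GRing.isLinear.Build _ _ _ _ f f_scalar.
pose fl : {scalar 'End(S)} := HB.pack f fL.
by exists fl.
Qed.

(** The adjoint is a choice among the maps with the adjunction property, so
    one such map has to be exhibited before anything is known about it. *)
Lemma entry_adjoint A i j : entry e (adjoint A) i j = (entry e A j i)^*.
Proof.
rewrite /adjoint /entry.
pose Bf v := \sum_l um_form S v (A (tnth e l)) *: tnth e l.
have Bf_linear : linear Bf.
  move=> a u u'; rewrite /Bf scaler_sumr -big_split/=; apply: eq_bigr => l _.
  by rewrite linearDl linearZl_LR/= scalerDl scalerA.
pose BL := GRing.isLinear.Build _ _ _ _ Bf Bf_linear.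
pose Bl : {linear S -> S} := HB.pack Bf BL.
case: xgetP => [B _ /= adjB|/(_ (linfun Bl))[]].
  by rewrite form_conj -adjB.
move=> u v; rewrite lfunE/= /Bf [u in LHS](onb_expand onb_e).
rewrite linear_sum/= linear_sumlz linear_sumr; apply: eq_bigr => l _.
rewrite linearZ/= linearZl_LR linearZr_LR/= mulrC; congr (_ * _).
exact: form_conj.
Qed.

Lemma entry_comp A B i k :
  entry e (A \o B)%VF i k = \sum_m entry e A i m * entry e B m k.
Proof.
rewrite /entry comp_lfunE [B _ in LHS](onb_expand onb_e) linear_sum/=.
rewrite linear_sumlz; apply: eq_bigr => l _.
by rewrite linearZ/= linearZl_LR mulrC.
Qed.

(** Vector-valued integrals are defined by the coordinates in some fixed basis
    of the endomorphisms; these are thereby reduced to the matrix entries in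
    [e], for which integrability can be checked. *)
Lemma functional_entries (f : {scalar 'End(S)}) :
  exists c : 'I_(um_dim S) -> 'I_(um_dim S) -> R[i],
    forall A, f A = \sum_i \sum_j c i j * entry e A i j.
Proof.
pose Ef i j u := um_form S u (tnth e j) *: tnth e i.
have Ef_linear i j : linear (Ef i j).
  by move=> a u u'; rewrite /Ef linearDl linearZl_LR scalerDl scalerA.
pose EL i j := GRing.isLinear.Build _ _ _ _ (Ef i j) (Ef_linear i j).
pose El i j : {linear S -> S} := HB.pack (Ef i j) (EL i j).
have EE i j u : linfun (El i j) u = um_form S u (tnth e j) *: tnth e i.
  by rewrite lfunE.
exists (fun i j => f (linfun (El i j))) => A.
have -> : f A = f (\sum_i \sum_j entry e A i j *: linfun (El i j)).
  congr (f _); apply/lfunP => u.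
  rewrite [u](onb_expand onb_e) !linear_sum/=; apply: eq_bigr => l _.
  rewrite !linearZ/=; congr (_ *: _).
  rewrite [LHS](onb_expand onb_e) sum_lfunE; apply: eq_bigr => i _.
  rewrite sum_lfunE (bigD1 l)// scale_lfunE EE onb_form// eqxx scale1r.
  rewrite big1; first by rewrite [RHS]addr0.
  move=> j jl; rewrite scale_lfunE EE onb_form//.
  by rewrite eq_sym (negbTE jl) scale0r scaler0.
rewrite linear_sum; apply: eq_bigr => i _; rewrite linear_sum.
by apply: eq_bigr => j _; rewrite linearZ mulrC.
Qed.

End Entries.

(** * Integration of complex and vector valued functions *)

Section ComplexParts.
Context (R : realType).
Implicit Types z w : R[i].

Lemma ReD z w : complex.Re (z + w) = complex.Re z + complex.Re w.
Proof. by case: z w => [a b] [c d]. Qed.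

Lemma ImD z w : complex.Im (z + w) = complex.Im z + complex.Im w.
Proof. by case: z w => [a b] [c d]. Qed.

Lemma ReM z w : complex.Re (z * w) =
  complex.Re z * complex.Re w - complex.Im z * complex.Im w.
Proof. by case: z w => [a b] [c d]. Qed.

Lemma ImM z w : complex.Im (z * w) =
  complex.Re z * complex.Im w + complex.Im z * complex.Re w.
Proof. by case: z w => [a b] [c d]. Qed.

Lemma ReJ z : complex.Re z^* = complex.Re z. Proof. by case: z. Qed.

Lemma ImJ z : complex.Im z^* = - complex.Im z. Proof. by case: z. Qed.

Definition partE := (ReD, ImD, ReM, ImM, ReJ, ImJ).

Lemma eq_parts z w :
  complex.Re z = complex.Re w -> complex.Im z = complex.Im w -> z = w.
Proof. by case: z w => [a b] [c d] /= -> ->. Qed.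

Lemma sqmod_ge0 z : 0 <= sqmod z.
Proof. by rewrite addr_ge0// sqr_ge0. Qed.

Lemma sqmodM z w : sqmod (z * w) = sqmod z * sqmod w.
Proof. rewrite /sqmod !partE; ring. Qed.

Lemma sqmodJ z : sqmod z^* = sqmod z.
Proof. by rewrite /sqmod !partE sqrrN. Qed.

Lemma normr_le_sqr (a b : R) : `|a| <= 1 + (a ^+ 2 + b ^+ 2).
Proof.
have := sqr_ge0 (a + 1); have := sqr_ge0 (a - 1).
have := sqr_ge0 a; have := sqr_ge0 b.
by rewrite !expr2 ler_norml => ? ? ? ?; apply/andP; split; lra.
Qed.

Lemma normr_mulD_le (a b c e : R) :
  `|a * b + c * e| <= a ^+ 2 + c ^+ 2 + (b ^+ 2 + e ^+ 2).
Proof.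
have := sqr_ge0 (a + b); have := sqr_ge0 (a - b).
have := sqr_ge0 (c + e); have := sqr_ge0 (c - e).
have := sqr_ge0 a; have := sqr_ge0 b; have := sqr_ge0 c; have := sqr_ge0 e.
by rewrite !expr2 ler_norml => *; apply/andP; split; lra.
Qed.

Lemma normr_ReM_sqmod z w : `|complex.Re (z * w)| <= sqmod z + sqmod w.
Proof.
rewrite partE -mulNr (le_trans (normr_mulD_le _ _ _ _))// sqrrN.
exact: lexx.
Qed.

Lemma normr_ImM_sqmod z w : `|complex.Im (z * w)| <= sqmod z + sqmod w.
Proof.
by rewrite partE (le_trans (normr_mulD_le _ _ _ _))// [X in _ + X <= _]addrC.
Qed.

Lemma sqmodD_le z w : sqmod (z + w) <= 2 * sqmod z + 2 * sqmod w.
Proof.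
have := sqr_ge0 (complex.Re z - complex.Re w).
have := sqr_ge0 (complex.Im z - complex.Im w).
by rewrite /sqmod !partE !expr2 => *; lra.
Qed.

End ComplexParts.

Section CMeasurable.
Context (R : realType) d (X : measurableType d).
Implicit Types f g : X -> R[i].

Lemma cmeasurableP f : cmeasurable f <->
  measurable_fun setT (fun x => complex.Re (f x)) /\
  measurable_fun setT (fun x => complex.Im (f x)).
Proof. exact: measurable_fun_pairP. Qed.

Lemma cmeasurable_cst (c : R[i]) : cmeasurable (fun _ : X => c).
Proof. by apply/cmeasurableP; split; exact: measurable_cst. Qed.

Lemma cmeasurableD f g :
  cmeasurable f -> cmeasurable g -> cmeasurable (fun x => f x + g x).
Proof.
move=> /cmeasurableP[fr fi] /cmeasurableP[gr gi]; apply/cmeasurableP; split.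
  by under eq_fun do rewrite partE; exact: measurable_funD.
by under eq_fun do rewrite partE; exact: measurable_funD.
Qed.

Lemma cmeasurableM f g :
  cmeasurable f -> cmeasurable g -> cmeasurable (fun x => f x * g x).
Proof.
move=> /cmeasurableP[fr fi] /cmeasurableP[gr gi]; apply/cmeasurableP; split.
  under eq_fun do rewrite partE.
  by apply: measurable_funB; exact: measurable_funM.
under eq_fun do rewrite partE.
by apply: measurable_funD; exact: measurable_funM.
Qed.

Lemma cmeasurableJ f : cmeasurable f -> cmeasurable (fun x => (f x)^*).
Proof.
move=> /cmeasurableP[fr fi]; apply/cmeasurableP; split.
  by under eq_fun do rewrite partE.
by under eq_fun do rewrite partE; exact: measurable_funN.
Qed.

Lemma cmeasurable_sum (I : Type) (s : seq I) (h : I -> X -> R[i]) :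
  (forall i, cmeasurable (h i)) -> cmeasurable (fun x => \sum_(i <- s) h i x).
Proof.
move=> mh; elim: s => [|i s ih].
  by under eq_fun do rewrite big_nil; exact: cmeasurable_cst.
by under eq_fun do rewrite big_cons; exact: cmeasurableD.
Qed.

Lemma measurable_sqmod f :
  cmeasurable f -> measurable_fun setT (fun x => sqmod (f x)).
Proof.
by move=> /cmeasurableP[fr fi]; apply: measurable_funD; exact: measurable_funX.
Qed.

Lemma cmeasurable_comp d' (Y : measurableType d') (h : Y -> X) f :
  measurable_fun setT h -> cmeasurable f -> cmeasurable (fun y => f (h y)).
Proof. by move=> mh mf; exact: (measurableT_comp mf mh). Qed.

End CMeasurable.

Section CIntegral.
Context (R : realType) d (X : measurableType d)
  (mu : {measure set X -> \bar R}).
Implicit Types f g : X -> R[i].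

Definition cintegrable f :=
  mu.-integrable setT (EFin \o (fun x => complex.Re (f x))) /\
  mu.-integrable setT (EFin \o (fun x => complex.Im (f x))).

Lemma cintegrable_measurable f : cintegrable f -> cmeasurable f.
Proof.
move=> [/measurable_int mr /measurable_int mi]; apply/cmeasurableP.
by split; exact/measurable_EFinP.
Qed.

Lemma le_cintegrable (g : X -> R) f : cmeasurable f ->
  (forall x, `|complex.Re (f x)| <= g x) ->
  (forall x, `|complex.Im (f x)| <= g x) ->
  mu.-integrable setT (EFin \o g) -> cintegrable f.
Proof.
move=> /cmeasurableP[mr mi] ler lei ig; split.
  apply: le_integrable ig => //; first exact/measurable_EFinP.
  by move=> x _ /=; rewrite lee_fin (le_trans (ler x))// ler_norm.
apply: le_integrable ig => //; first exact/measurable_EFinP.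
by move=> x _ /=; rewrite lee_fin (le_trans (lei x))// ler_norm.
Qed.

Lemma cintegrable_ext f g : f =1 g -> cintegrable f -> cintegrable g.
Proof. by move=> /funext ->. Qed.

Lemma eq_cintegral f g : f =1 g -> cintegral mu f = cintegral mu g.
Proof. by move=> /funext ->. Qed.

Lemma cintegrableD f g :
  cintegrable f -> cintegrable g -> cintegrable (fun x => f x + g x).
Proof.
move=> [fr fi] [gr gi]; split.
  apply: eq_integrable (integrableD _ fr gr) => // x _.
  by rewrite /= partE EFinD.
apply: eq_integrable (integrableD _ fi gi) => // x _.
by rewrite /= partE EFinD.
Qed.

Lemma cintegralD f g : cintegrable f -> cintegrable g ->
  cintegral mu (fun x => f x + g x) = cintegral mu f + cintegral mu g.
Proof.
move=> [fr fi] [gr gi]; apply: eq_parts; rewrite partE /=.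
  by under eq_Rintegral do rewrite partE; rewrite RintegralD.
by under eq_Rintegral do rewrite partE; rewrite RintegralD.
Qed.

Lemma cintegrableZl c f : cintegrable f -> cintegrable (fun x => c * f x).
Proof.
move=> [fr fi]; split.
  have := integrableB measurableT (integrableZl measurableT (complex.Re c) fr)
                      (integrableZl measurableT (complex.Im c) fi).
  by apply: eq_integrable => // x _; rewrite /= partE EFinB.
have := integrableD measurableT (integrableZl measurableT (complex.Re c) fi)
                    (integrableZl measurableT (complex.Im c) fr).
by apply: eq_integrable => // x _; rewrite /= partE EFinD.
Qed.

Lemma cintegralZl c f : cintegrable f ->
  cintegral mu (fun x => c * f x) = c * cintegral mu f.
Proof.
have iZ a (h : X -> R) : mu.-integrable setT (EFin \o h) ->
    mu.-integrable setT (EFin \o (fun x => a * h x)).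
  move=> ih; apply: eq_integrable (integrableZl measurableT a ih) => //.
move=> [fr fi]; apply: eq_parts; rewrite partE /=.
  under eq_Rintegral do rewrite partE.
  by rewrite RintegralB ?RintegralZl//; exact: iZ.
under eq_Rintegral do rewrite partE.
by rewrite RintegralD ?RintegralZl//; exact: iZ.
Qed.

Lemma cintegralZr c f : cintegrable f ->
  cintegral mu (fun x => f x * c) = cintegral mu f * c.
Proof.
by move=> fi; rewrite mulrC -cintegralZl//; apply: eq_cintegral => x;
  rewrite mulrC.
Qed.

Lemma cintegralJ f : cintegrable f ->
  cintegral mu (fun x => (f x)^*) = (cintegral mu f)^*.
Proof.
move=> [fr fi]; apply: eq_parts; rewrite partE /=.
  by apply: eq_Rintegral => x _; rewrite partE.
rewrite -mulN1r -RintegralZl//.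
by apply: eq_Rintegral => x _; rewrite partE mulN1r.
Qed.

Lemma cintegral0 : cintegral mu (fun=> 0) = 0.
Proof. by rewrite /cintegral/= Rintegral_cst// mul0r. Qed.

Lemma cintegrable0 : cintegrable (fun=> 0).
Proof. by split; exact: integrable0. Qed.

Lemma cintegrable_sum (I : Type) (s : seq I) (h : I -> X -> R[i]) :
  (forall i, cintegrable (h i)) -> cintegrable (fun x => \sum_(i <- s) h i x).
Proof.
move=> ih; elim: s => [|i s IH].
  by under eq_fun do rewrite big_nil; exact: cintegrable0.
by under eq_fun do rewrite big_cons; exact: cintegrableD.
Qed.

Lemma cintegral_sum (I : Type) (s : seq I) (h : I -> X -> R[i]) :
  (forall i, cintegrable (h i)) ->
  cintegral mu (fun x => \sum_(i <- s) h i x) =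
  \sum_(i <- s) cintegral mu (h i).
Proof.
move=> ih; elim: s => [|i s IH].
  by under eq_fun do rewrite big_nil; rewrite big_nil cintegral0.
under eq_fun do rewrite big_cons; rewrite big_cons cintegralD// ?IH//.
exact: cintegrable_sum.
Qed.

Lemma ae_eq_cintegral f g : cmeasurable f -> cmeasurable g ->
  {ae mu, forall x, f x = g x} -> cintegral mu f = cintegral mu g.
Proof.
move=> /cmeasurableP[fr fi] /cmeasurableP[gr gi] fg.
apply: eq_parts; congr fine; apply: ae_eq_integral => //;
  (try exact/measurable_EFinP); by apply: filterS fg => x /= ->.
Qed.

End CIntegral.

Section EqualLaws.
Context (R : realType) d1 d2 d3 (X1 : measurableType d1)
  (X2 : measurableType d2) (V : measurableType d3).
Context (m1 : {measure set X1 -> \bar R}) (m2 : {measure set X2 -> \bar R}).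
Context (phi : X1 -> V) (psi : X2 -> V).
Hypotheses (mphi : measurable_fun setT phi) (mpsi : measurable_fun setT psi).
Hypothesis law : forall B, measurable B -> m1 (phi @^-1` B) = m2 (psi @^-1` B).

Lemma ge0_integral_eq_law (f : V -> \bar R) :
  measurable_fun setT f -> (forall v, 0 <= f v)%E ->
  (\int[m1]_x f (phi x) = \int[m2]_x f (psi x))%E.
Proof.
move=> mf f0.
rewrite -[LHS](@ge0_integral_pushforward _ _ _ _ _ _ mphi m1 setT f)//.
rewrite -[RHS](@ge0_integral_pushforward _ _ _ _ _ _ mpsi m2 setT f)//.
by apply: eq_measure_integral => A mA _; exact: (law mA).
Qed.

Lemma cintegral_eq_law (f : V -> R[i]) : cmeasurable f ->
  cintegral m1 (fun x => f (phi x)) = cintegral m2 (fun x => f (psi x)).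
Proof.
move=> /cmeasurableP[mr mi].
have key (k : V -> R) : measurable_fun setT k ->
    Rintegral m1 setT (fun x => k (phi x)) = Rintegral m2 setT (fun x => k (psi x)).
  move=> /measurable_EFinP mk; congr fine; rewrite integralE [RHS]integralE.
  congr (_ - _)%E.
    transitivity (\int[m1]_x (EFin \o k)^\+ (phi x))%E.
      by apply: eq_integral => x _; rewrite !funeposE.
    rewrite (ge0_integral_eq_law (measurable_funepos mk))//.
    by apply: eq_integral => x _; rewrite !funeposE.
  transitivity (\int[m1]_x (EFin \o k)^\- (phi x))%E.
    by apply: eq_integral => x _; rewrite !funenegE.
  rewrite (ge0_integral_eq_law (measurable_funeneg mk))//.
  by apply: eq_integral => x _; rewrite !funenegE.
by apply: eq_parts; [exact: key mr|exact: key mi].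
Qed.

End EqualLaws.

Lemma cintegral_pushforward (R : realType) d (X : measurableType d)
    (mu : {measure set X -> \bar R}) (h : X -> X) (f : X -> R[i]) :
  measurable_fun setT h ->
  (forall A, measurable A -> mu (h @^-1` A) = mu A) -> cmeasurable f ->
  cintegral mu (fun x => f (h x)) = cintegral mu f.
Proof.
by move=> mh inv mf; exact: (cintegral_eq_law mh (@measurable_id _ _ setT) inv mf).
Qed.

Section VectorIntegral.
Context (R : realType) d (X : measurableType d)
  (mu : {measure set X -> \bar R}) (V : vectType R[i]) (f : X -> V).

Lemma vintegral_functional (phi : {scalar V}) :
  (forall m, cintegrable mu (fun x => coord (vbasis fullv) m (f x))) ->
  phi (vintegral mu f) = cintegral mu (fun x => phi (f x)).
Proof.
move=> intf; rewrite /vintegral linear_sum/=.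
have -> : (fun x => phi (f x)) = (fun x => \sum_(m < \dim (fullv : {vspace V}))
    phi (vbasis fullv)`_m * coord (vbasis fullv) m (f x)).
  apply/funext => x; rewrite {1}(coord_vbasis (memvf (f x))) linear_sum/=.
  by apply: eq_bigr => m _; rewrite linearZ/= mulrC.
rewrite cintegral_sum; last by move=> m; exact: cintegrableZl.
by apply: eq_bigr => m _; rewrite linearZ/= cintegralZl// mulrC.
Qed.

End VectorIntegral.

(** * Square integrable functions and Fubini's theorem *)

Section SquareIntegrable.
Context (R : realType) d (X : measurableType d) (mu : probability X R).
Implicit Types f g : X -> R[i].

Lemma square_integrable_sqmod f : square_integrable mu f ->
  mu.-integrable setT (EFin \o (fun x => sqmod (f x))).
Proof.
move=> [mf foo]; apply/integrableP; split.
  exact/measurable_EFinP/measurable_sqmod.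
under eq_integral do rewrite /= ger0_norm ?sqmod_ge0//.
exact: foo.
Qed.

Lemma square_integrableM f g :
  square_integrable mu f -> square_integrable mu g ->
  cintegrable mu (fun x => f x * g x).
Proof.
move=> if2 ig2; apply: (@le_cintegrable _ _ _ _ (fun x => sqmod (f x) + sqmod (g x))).
- by apply: cmeasurableM; [case: if2|case: ig2].
- by move=> x; exact: normr_ReM_sqmod.
- by move=> x; exact: normr_ImM_sqmod.
- apply: eq_integrable (integrableD _ (square_integrable_sqmod if2)
    (square_integrable_sqmod ig2)) => //.
Qed.

Lemma square_integrableJ f :
  square_integrable mu f -> square_integrable mu (fun x => (f x)^*).
Proof.
move=> [mf foo]; split; first exact: cmeasurableJ.
by under eq_integral do rewrite sqmodJ.
Qed.

Lemma square_integrable_cst c : square_integrable mu (fun=> c).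
Proof.
split; first exact: cmeasurable_cst.
rewrite integral_cst// [X in (_ * X)%E](_ : _ = 1%E); last exact: probability_setT.
by rewrite mule1 ltry.
Qed.

Lemma square_integrable_cintegrable f :
  square_integrable mu f -> cintegrable mu f.
Proof.
move=> f2; apply: cintegrable_ext (square_integrableM f2 (square_integrable_cst 1)).
by move=> x; rewrite mulr1.
Qed.

Lemma integral_sqmodM_le f g (M : R) : cmeasurable f -> cmeasurable g ->
  (forall x, sqmod (g x) <= M) ->
  (\int[mu]_x (sqmod (f x * g x))%:E <= M%:E * \int[mu]_x (sqmod (f x))%:E)%E.
Proof.
move=> mf mg gM.
have M0 : 0 <= M by exact: le_trans (sqmod_ge0 _) (gM point).
rewrite -ge0_integralZl//; last 2 first.
- exact/measurable_EFinP/measurable_sqmod.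
- by move=> x _; rewrite lee_fin sqmod_ge0.
apply: ge0_le_integral => //.
- by move=> x _; rewrite lee_fin sqmod_ge0.
- exact/measurable_EFinP/measurable_sqmod/cmeasurableM.
- by apply: measurable_funeM; exact/measurable_EFinP/measurable_sqmod.
- by move=> x _; rewrite -EFinM lee_fin sqmodM mulrC ler_wpM2r// sqmod_ge0.
Qed.

Lemma square_integrable_bounded f g (M : R) :
  square_integrable mu f -> cmeasurable g -> (forall x, sqmod (g x) <= M) ->
  square_integrable mu (fun x => f x * g x).
Proof.
move=> [mf foo] mg gM; split; first exact: cmeasurableM.
apply: le_lt_trans (integral_sqmodM_le mf mg gM) _.
rewrite lte_mul_pinfty//.
by rewrite lee_fin (le_trans (sqmod_ge0 _) (gM point)).
Qed.

Lemma square_integrableZl f c :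
  square_integrable mu f -> square_integrable mu (fun x => c * f x).
Proof.
move=> f2; have := square_integrable_bounded f2 (cmeasurable_cst c) (fun=> lexx _).
by under eq_fun do rewrite mulrC.
Qed.

Lemma square_integrableD f g : square_integrable mu f ->
  square_integrable mu g -> square_integrable mu (fun x => f x + g x).
Proof.
move=> f2 g2; have [mf _] := f2; have [mg _] := g2.
split; first exact: cmeasurableD.
have i2 h : square_integrable mu h ->
    mu.-integrable setT (EFin \o (fun x => 2 * sqmod (h x))).
  move=> h2.
  by apply: eq_integrable (integrableZl measurableT 2 (square_integrable_sqmod h2)).
have := integrableD measurableT (i2 _ f2) (i2 _ g2).
move=> /(integrable_lty measurableT); apply: le_lt_trans.
apply: ge0_le_integral => //.
- by move=> x _; rewrite lee_fin sqmod_ge0.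
- exact/measurable_EFinP/measurable_sqmod/cmeasurableD.
- by apply: emeasurable_funD; apply: measurable_int; exact: i2.
- by move=> x _; rewrite lee_fin sqmodD_le.
Qed.

Lemma square_integrable_sum (I : Type) (s : seq I) (h : I -> X -> R[i]) :
  (forall i, square_integrable mu (h i)) ->
  square_integrable mu (fun x => \sum_(i <- s) h i x).
Proof.
move=> h2; elim: s => [|i s IH].
  by under eq_fun do rewrite big_nil; exact: square_integrable_cst.
by under eq_fun do rewrite big_cons; exact: square_integrableD.
Qed.

(** Integrate the tangent line bound [2 m t - m^2 <= t^2] taken at the mean
    [m] of [f]. *)
Lemma sqr_Rintegral_le (f : X -> R) : measurable_fun setT f ->
  ((Rintegral mu setT f ^+ 2)%:E <= \int[mu]_x (f x ^+ 2)%:E)%E.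
Proof.
move=> mf.
have [->|] := eqVneq (\int[mu]_x (f x ^+ 2)%:E)%E +oo%E; first exact: leey.
rewrite -ltey => f2oo.
have if2 : mu.-integrable setT (EFin \o (fun x => f x ^+ 2)).
  apply/integrableP; split; first exact/measurable_EFinP/measurable_funX.
  by under eq_integral do rewrite /= ger0_norm ?sqr_ge0//.
have icst c : mu.-integrable setT (EFin \o (fun _ : X => c)).
  exact: finite_measure_integrable_cst.
have i1 : mu.-integrable setT (EFin \o f).
  have := integrableD measurableT (icst 1) if2.
  apply: le_integrable => //; first exact/measurable_EFinP.
  move=> x _ /=; rewrite lee_fin (le_trans _ (ler_norm _))//.
  by rewrite (le_trans (normr_le_sqr _ 0))// expr0n/= addr0.
set m := Rintegral _ _ _.
have i2 : mu.-integrable setT (EFin \o (fun x => 2 * m * f x)).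
  exact: eq_integrable (integrableZl measurableT (2 * m) i1).
have -> : (\int[mu]_x (f x ^+ 2)%:E)%E = (Rintegral mu setT (fun x => f x ^+ 2))%:E.
  by rewrite /Rintegral fineK//; exact: (integrable_fin_num measurableT if2).
rewrite lee_fin.
have <- : Rintegral mu setT (fun x => 2 * m * f x - m ^+ 2) = m ^+ 2.
  rewrite RintegralB// RintegralZl// Rintegral_cst//.
  rewrite [X in fine X](_ : _ = 1%E); last exact: probability_setT.
  by rewrite /= -/m; ring.
apply: le_Rintegral => //.
  by apply: eq_integrable (integrableB measurableT i2 (icst (m ^+ 2))).
move=> x _; have := sqr_ge0 (f x - m); rewrite !expr2 => ?; lra.
Qed.

(** Jensen's inequality, stated in the extended reals so that it also covers
    the functions that are not square integrable. *)
Lemma sqmod_cintegral_le f : cmeasurable f ->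
  ((sqmod (cintegral mu f))%:E <= \int[mu]_x (sqmod (f x))%:E)%E.
Proof.
move=> /cmeasurableP[mr mi]; rewrite /sqmod EFinD.
under eq_integral do rewrite EFinD.
rewrite ge0_integralD//.
- by apply: leeD; exact: sqr_Rintegral_le.
- by move=> x _; rewrite lee_fin sqr_ge0.
- exact/measurable_EFinP/measurable_funX.
- by move=> x _; rewrite lee_fin sqr_ge0.
- exact/measurable_EFinP/measurable_funX.
Qed.

End SquareIntegrable.

Section ComplexFubini.
Context (R : realType) d1 d2 (X : measurableType d1) (Y : measurableType d2).
Context (m1 : probability X R) (m2 : probability Y R).

Section RealFubini.
Context (f : X * Y -> R).
Hypothesis intf : (m1 \x m2)%E.-integrable setT (EFin \o f).

Lemma integrable_Rintegral1 :
  m1.-integrable setT (EFin \o (fun x => Rintegral m2 setT (fun y => f (x, y)))).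
Proof.
have iF := integrable_fubini_F intf.
apply: le_integrable iF => //.
  apply/measurable_EFinP; apply: measurableT_comp => //.
  exact: measurable_fubini_F intf.
move=> x _; rewrite /= /Rintegral /fubini_F /=.
by case: (integral _ _ _) => //=; rewrite leey.
Qed.

Lemma integrable_Rintegral2 :
  m2.-integrable setT (EFin \o (fun y => Rintegral m1 setT (fun x => f (x, y)))).
Proof.
have mG := measurable_fubini_G intf.
have mfG : measurable_fun setT
    (EFin \o (fun y => Rintegral m1 setT (fun x => f (x, y)))).
  by apply/measurable_EFinP; apply: measurableT_comp.
have mf : measurable_fun setT (EFin \o f) by exact: measurable_int intf.
apply/integrableP; split=> //.
apply: le_lt_trans ((integrable21ltyP m1 m2 mf).1 intf).
apply: ge0_le_integral => //.
- exact: measurableT_comp.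
- apply: (@measurable_fun_fubini_tonelli_G _ _ _ _ _ m1 (fun z => `|(EFin \o f) z|%E)) => //.
  exact: measurableT_comp.
- move=> y _; apply: (@le_trans _ _ `|\int[m1]_x (f (x, y))%:E|%E).
    by rewrite /= /Rintegral; case: (integral _ _ _) => //=; rewrite leey.
  apply: le_abse_integral => //; apply/measurable_EFinP.
  by apply: (measurableT_comp (f := f)) => //; exact/measurable_EFinP.
Qed.

Lemma Rintegral_Fubini :
  Rintegral m1 setT (fun x => Rintegral m2 setT (fun y => f (x, y))) =
  Rintegral m2 setT (fun y => Rintegral m1 setT (fun x => f (x, y))).
Proof.
have [a1 a2] := (ae_integrable1 intf, ae_integrable2 intf).
have fin1 : {ae m1, forall x, (Rintegral m2 setT (fun y => f (x, y)))%:E =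
    (\int[m2]_y (f (x, y))%:E)%E}.
  apply: filterS a1 => x ix; rewrite /Rintegral fineK//.
  exact: (integrable_fin_num measurableT ix).
have fin2 : {ae m2, forall y, (Rintegral m1 setT (fun x => f (x, y)))%:E =
    (\int[m1]_x (f (x, y))%:E)%E}.
  apply: filterS a2 => y iy; rewrite /Rintegral fineK//.
  exact: (integrable_fin_num measurableT iy).
congr fine.
transitivity (\int[m1]_x \int[m2]_y (f (x, y))%:E)%E.
  apply: ae_eq_integral => //.
  - exact: measurable_int integrable_Rintegral1.
  - exact: measurable_fubini_F intf.
  - by apply: filterS fin1 => x ->.
transitivity (\int[m2]_y \int[m1]_x (f (x, y))%:E)%E.
  exact: (Fubini intf).
apply: ae_eq_integral => //.
- exact: measurable_fubini_G intf.
- exact: measurable_int integrable_Rintegral2.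
- by apply: filterS fin2 => x ->.
Qed.

End RealFubini.

Context (f : X * Y -> R[i]).
Hypothesis intf : cintegrable (m1 \x m2)%E f.

Lemma cintegrable_cintegral1 :
  cintegrable m1 (fun x => cintegral m2 (fun y => f (x, y))).
Proof.
by have [ir ii] := intf; split; [exact: integrable_Rintegral1 ir|
  exact: integrable_Rintegral1 ii].
Qed.

Lemma cintegrable_cintegral2 :
  cintegrable m2 (fun y => cintegral m1 (fun x => f (x, y))).
Proof.
by have [ir ii] := intf; split; [exact: integrable_Rintegral2 ir|
  exact: integrable_Rintegral2 ii].
Qed.

Lemma cintegral_Fubini :
  cintegral m1 (fun x => cintegral m2 (fun y => f (x, y))) =
  cintegral m2 (fun y => cintegral m1 (fun x => f (x, y))).
Proof.
have [ir ii] := intf.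
by apply: eq_parts; [exact: Rintegral_Fubini ir|exact: Rintegral_Fubini ii].
Qed.

End ComplexFubini.

(** * Averages of second-order fields against bounded functions *)

Section SecondOrderFields.
Context (R : realType) d1 d2 (X : measurableType d1) (W : measurableType d2).
Context (mu : probability X R) (P : probability W R) (Y : X -> W -> R[i]).
Hypothesis mY : cmeasurable (fun p : X * W => Y p.1 p.2).
Context (c : R).
Hypothesis Yc : forall x, (\int[P]_w (sqmod (Y x w))%:E <= c%:E)%E.

Definition bounded_multiplier (a : X -> R[i]) :=
  cmeasurable a /\ exists M : R, forall x, sqmod (a x) <= M.

Definition mean_against (a : X -> R[i]) (w : W) : R[i] :=
  cintegral mu (fun x => Y x w * a x).

Definition covkernel (x y : X) : R[i] := expect P (fun w => Y x w * (Y y w)^*).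

Lemma cmeasurable_section1 x : cmeasurable (Y x).
Proof.
exact: (cmeasurable_comp (h := fun w => (x, w)) (measurable_pair1 x) mY).
Qed.

Lemma cmeasurable_section2 w : cmeasurable (Y ^~ w).
Proof.
exact: (cmeasurable_comp (h := fun x => (x, w)) (measurable_pair2 w) mY).
Qed.

Lemma square_integrable_section x : square_integrable P (Y x).
Proof.
by split; [exact: cmeasurable_section1|exact: le_lt_trans (Yc x) (ltry _)].
Qed.

Let sqY (p : X * W) := (sqmod (Y p.1 p.2))%:E.

Let energy w := (\int[mu]_x (sqmod (Y x w))%:E)%E.

Let sqY_ge0 p : (0 <= sqY p)%E. Proof. by rewrite lee_fin sqmod_ge0. Qed.

Let measurable_sqY : measurable_fun [set: X * W] sqY.
Proof. by have := measurable_sqmod mY; move=> /measurable_EFinP. Qed.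

Let energy_ge0 w : (0 <= energy w)%E.
Proof. by apply: integral_ge0 => x _; rewrite lee_fin sqmod_ge0. Qed.

Let measurable_energy : measurable_fun setT energy.
Proof. exact: (measurable_fun_fubini_tonelli_G sqY measurable_sqY sqY_ge0). Qed.

Let integral_energy : (\int[P]_w energy w < +oo)%E.
Proof.
have <- := fubini_tonelli sqY measurable_sqY sqY_ge0.
apply: (@le_lt_trans _ _ (\int[mu]_x (cst c x)%:E)%E).
  apply: ge0_le_integral => //.
  - by move=> x _; exact: integral_ge0.
  - exact: (measurable_fun_fubini_tonelli_F sqY measurable_sqY sqY_ge0).
  - by apply/measurable_EFinP; exact: measurable_cst.
  - by move=> x _; exact: Yc.
exact: (integrable_lty measurableT
  (finite_measure_integrable_cst mu c measurableT)).
Qed.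

Let integrable_energy : P.-integrable setT energy.
Proof.
apply/integrableP; split; first exact: measurable_energy.
under eq_integral do rewrite gee0_abs ?energy_ge0//.
exact: integral_energy.
Qed.

Let bounded_energy M : (\int[P]_w (M%:E * energy w) < +oo)%E.
Proof.
exact: (integrable_lty measurableT
  (integrableZl measurableT M integrable_energy)).
Qed.

Lemma ae_square_integrable : {ae P, forall w, square_integrable mu (Y ^~ w)}.
Proof.
have := integrable_ae measurableT integrable_energy; apply: filterS => w /(_ I) fin.
by split; [exact: cmeasurable_section2|rewrite -/(energy w) ltey_eq fin].
Qed.

Lemma cintegrable_multiplier a w : bounded_multiplier a ->
  square_integrable mu (Y ^~ w) -> cintegrable mu (fun x => Y x w * a x).
Proof.
move=> [ma [M aM]] w2.
exact/square_integrable_cintegrable/(square_integrable_bounded w2 ma aM).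
Qed.

Lemma ae_cintegrable_multiplier a : bounded_multiplier a ->
  {ae P, forall w, cintegrable mu (fun x => Y x w * a x)}.
Proof.
by move=> ba; apply: filterS ae_square_integrable => w; exact: cintegrable_multiplier.
Qed.

Section Multiplier.
Context (a : X -> R[i]) (ba : bounded_multiplier a).

Let ma : cmeasurable (fun p : X * W => a p.1).
Proof.
by have [ma _] := ba; exact: (cmeasurable_comp (h := fst) measurable_fst ma).
Qed.

Let mYZ (Z : W -> R[i]) : cmeasurable Z ->
  cmeasurable (fun p : X * W => Y p.1 p.2 * a p.1 * Z p.2).
Proof.
move=> mZ; apply: cmeasurableM; first exact: cmeasurableM.
exact: (cmeasurable_comp (h := snd) measurable_snd mZ).
Qed.

(** [|Y a Z| <= |Y a|^2 + |Z|^2], and both terms have finite integral. *)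
Let intYZ (Z : W -> R[i]) : square_integrable P Z ->
  cintegrable (mu \x P)%E (fun p => Y p.1 p.2 * a p.1 * Z p.2).
Proof.
move=> Z2; have [mZ _] := Z2; have [ma0 [M aM]] := ba.
have mZ2 : measurable_fun [set: X * W] (fun p => sqmod (Z p.2)).
  apply: measurable_sqmod.
  exact: (cmeasurable_comp (h := snd) measurable_snd mZ).
have mYa : measurable_fun [set: X * W] (fun p => sqmod (Y p.1 p.2 * a p.1)).
  by apply: measurable_sqmod; exact: cmeasurableM.
apply: (@le_cintegrable _ _ _ _
    (fun p => sqmod (Y p.1 p.2 * a p.1) + sqmod (Z p.2))).
- exact: mYZ.
- by move=> p; exact: normr_ReM_sqmod.
- by move=> p; exact: normr_ImM_sqmod.
have mE : measurable_fun [set: X * W]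
    (fun p => (sqmod (Y p.1 p.2 * a p.1) + sqmod (Z p.2))%:E).
  exact/measurable_EFinP/measurable_funD.
apply: (integrable21ltyP mu P mE).2 => /=.
apply: (@le_lt_trans _ _ (\int[P]_w (M%:E * energy w + (sqmod (Z w))%:E))%E).
  apply: ge0_le_integral => //.
  - by move=> w _; apply: integral_ge0.
  - apply: (@measurable_fun_fubini_tonelli_G _ _ _ _ _ mu
      (fun p => `|(sqmod (Y p.1 p.2 * a p.1) + sqmod (Z p.2))%:E|%E)) => //.
    exact: measurableT_comp.
  - apply: emeasurable_funD; last exact/measurable_EFinP/measurable_sqmod.
    exact: measurable_funeM.
  - move=> w _.
    have -> : (fun x => `|sqmod (Y x w * a x) + sqmod (Z w)|%:E) =
        (fun x => (sqmod (Y x w * a x))%:E + (sqmod (Z w))%:E)%E.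
      by apply/funext => x; rewrite ger0_norm ?EFinD// addr_ge0 ?sqmod_ge0.
    have mw := cmeasurable_section2 w.
    rewrite ge0_integralD//.
    + apply: leeD; first exact: integral_sqmodM_le.
      rewrite integral_cst// [X in (_ * X)%E](_ : _ = 1%E) ?mule1//.
      exact: probability_setT.
    + by move=> x _; rewrite lee_fin sqmod_ge0.
    + exact/measurable_EFinP/measurable_sqmod/cmeasurableM.
    + by move=> x _; rewrite lee_fin sqmod_ge0.
rewrite ge0_integralD//.
- by apply: lte_add_pinfty; [exact: bounded_energy|case: Z2].
- by move=> w _; rewrite mule_ge0// lee_fin (le_trans (sqmod_ge0 _) (aM point)).
- exact: measurable_funeM.
- by move=> w _; rewrite lee_fin sqmod_ge0.
- exact/measurable_EFinP/measurable_sqmod.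
Qed.

(** Measurability holds on all of [W] because it comes from Fubini's theorem,
    and Jensen's inequality bounds the square modulus at every sample. *)
Lemma square_integrable_mean : square_integrable P (mean_against a).
Proof.
have [ma0 [M aM]] := ba.
have mI : cmeasurable (mean_against a).
  have i1 := cintegrable_cintegral2 (intYZ (square_integrable_cst P 1)).
  have := cintegrable_measurable i1.
  by under eq_fun do under eq_cintegral do rewrite mulr1.
split=> //; apply: (@le_lt_trans _ _ (\int[P]_w (M%:E * energy w))%E).
  apply: ge0_le_integral => //.
  - by move=> w _; rewrite lee_fin sqmod_ge0.
  - exact/measurable_EFinP/measurable_sqmod.
  - exact: measurable_funeM.
  - move=> w _; have mw := cmeasurable_section2 w.
    apply: le_trans (integral_sqmodM_le mu mw ma0 aM).
    exact/sqmod_cintegral_le/cmeasurableM.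
exact: bounded_energy.
Qed.

Lemma expect_meanM Z : square_integrable P Z ->
  expect P (fun w => mean_against a w * Z w) =
  cintegral mu (fun x => a x * expect P (fun w => Y x w * Z w)).
Proof.
move=> Z2; have i0 := intYZ Z2; have [mZ _] := Z2.
transitivity (cintegral mu (fun x => cintegral P (fun w => Y x w * a x * Z w))).
  have /= -> := cintegral_Fubini i0.
  apply: ae_eq_cintegral.
  - by apply: cmeasurableM => //; case: square_integrable_mean.
  - exact: cintegrable_measurable (cintegrable_cintegral2 i0).
  - apply: filterS (ae_cintegrable_multiplier ba) => w iw /=.
    by rewrite [RHS]cintegralZr.
apply: eq_cintegral => x; rewrite -cintegralZl.
  by apply: eq_cintegral => w; rewrite mulrAC mulrC mulrA.
exact: (square_integrableM (square_integrable_section x) Z2).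
Qed.

(** The change of variables under [mu] requires a measurable integrand. *)
Lemma cmeasurable_expectM Z : square_integrable P Z ->
  cmeasurable (fun x => a x * expect P (fun w => Y x w * Z w)).
Proof.
move=> Z2; have := cintegrable_measurable (cintegrable_cintegral1 (intYZ Z2)).
congr cmeasurable; apply/funext => x /=; rewrite -cintegralZl.
  by apply: eq_cintegral => w; rewrite mulrAC mulrC mulrA.
exact: (square_integrableM (square_integrable_section x) Z2).
Qed.

End Multiplier.

Lemma expect_mean a : bounded_multiplier a ->
  expect P (mean_against a) = cintegral mu (fun x => a x * expect P (Y x)).
Proof.
move=> ba; transitivity (expect P (fun w => mean_against a w * 1)).
  by apply: eq_cintegral => w; rewrite mulr1.
rewrite (expect_meanM ba (square_integrable_cst P 1)).
apply: eq_cintegral => x; congr (_ * _).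
by apply: eq_cintegral => w; rewrite mulr1.
Qed.

(** Exchanging expectation and integral twice expresses the second moments of
    the averages by the covariance kernel alone. *)
Lemma expect_mean_pair a b : bounded_multiplier a -> bounded_multiplier b ->
  expect P (fun w => mean_against a w * (mean_against b w)^*) =
  cintegral mu (fun x => a x *
    (cintegral mu (fun y => b y * covkernel y x))^*).
Proof.
move=> ba bb; have b2 := square_integrable_mean bb.
rewrite (expect_meanM ba (square_integrableJ b2)).
apply: eq_cintegral => x; congr (_ * _).
have Y2 := square_integrable_section x.
rewrite -(expect_meanM bb (square_integrableJ Y2)).
rewrite -cintegralJ; last exact: square_integrableM b2 (square_integrableJ Y2).
by apply: eq_cintegral => w; rewrite rmorphM/= conjCK mulrC.
Qed.

Section Translation.
Context (s : X -> X) (ms : measurable_fun setT s).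
Hypothesis mus : forall A, measurable A -> mu (s @^-1` A) = mu A.

Lemma expect_mean_translate a : bounded_multiplier a ->
  (forall x, expect P (Y (s x)) = expect P (Y x)) ->
  expect P (mean_against (a \o s)) = expect P (mean_against a).
Proof.
move=> ba inv.
have bas : bounded_multiplier (a \o s).
  have [ma [M aM]] := ba; split; first exact: (cmeasurable_comp ms ma).
  by exists M => x; exact: aM.
rewrite (expect_mean bas) (expect_mean ba) -[RHS](cintegral_pushforward ms mus).
  by apply: eq_cintegral => x /=; rewrite inv.
have := cmeasurable_expectM ba (square_integrable_cst P 1).
congr cmeasurable; apply/funext => x; congr (_ * _).
by apply: eq_cintegral => w; rewrite mulr1.
Qed.

(** In the iterated integral of the covariance kernel the two variables can be
    translated one after the other, by the invariance of [mu]. *)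
Lemma expect_mean_pair_translate a b :
  bounded_multiplier a -> bounded_multiplier b ->
  (forall x y, covkernel (s x) (s y) = covkernel x y) ->
  expect P (fun w => mean_against (a \o s) w * (mean_against (b \o s) w)^*) =
  expect P (fun w => mean_against a w * (mean_against b w)^*).
Proof.
move=> ba bb inv.
have bs f : bounded_multiplier f -> bounded_multiplier (f \o s).
  move=> [mf [M fM]]; split; first exact: (cmeasurable_comp ms mf).
  by exists M => x; exact: fM.
have E x : cintegral mu (fun y => b (s y) * covkernel y x) =
    cintegral mu (fun y => b y * covkernel y (s x)).
  have Ysx2 := square_integrable_section (s x).
  have m := cmeasurable_expectM bb (square_integrableJ Ysx2).
  rewrite -[RHS](cintegral_pushforward ms mus m).
  by apply: eq_cintegral => y /=; rewrite -[covkernel y x]inv.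
rewrite (expect_mean_pair (bs _ ba) (bs _ bb)) (expect_mean_pair ba bb).
rewrite -[RHS](cintegral_pushforward ms mus).
  by apply: eq_cintegral => x /=; rewrite E.
have b2 := square_integrable_mean bb.
have := cmeasurable_expectM ba (square_integrableJ b2).
congr cmeasurable; apply/funext => x; congr (_ * _).
have Y2 := square_integrable_section x.
rewrite -(expect_meanM bb (square_integrableJ Y2)).
rewrite -cintegralJ; last exact: square_integrableM b2 (square_integrableJ Y2).
by apply: eq_cintegral => w; rewrite rmorphM/= conjCK mulrC.
Qed.

End Translation.

End SecondOrderFields.

(** * The action on the homogeneous space and matrix coefficients *)

Section BorelMaps.
Context (X : ptopologicalType).

Lemma continuous_borel (Y : ptopologicalType) (f : X -> Y) :
  continuous f -> measurable_fun [set: borel X] (f : borel X -> borel Y).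
Proof.
move=> /continuousP cf.
apply: (@measurability _ _ (borel X) (borel Y) setT f (@open Y)) => //.
move=> _ [A oA <-]; rewrite setTI; apply: sub_sigma_algebra; exact: cf.
Qed.

Lemma continuous_borel_real (R : realType) (f : X -> R) :
  continuous f -> measurable_fun [set: borel X] (f : borel X -> R).
Proof.
move=> /continuousP cf; apply: (measurability _ (RGenOpens.measurableE R)).
move=> _ [_ [a [b ->] <-]]; rewrite setTI; apply: sub_sigma_algebra.
exact/cf/interval_open.
Qed.

End BorelMaps.

Section HomogeneousSpace.
Context (G : topologicalGroupType) (K : groupClosed G).
Implicit Types (g h k : G) (x y : lcosets K).

Lemma continuous_lmul k : continuous (fun g : G => (k * g)%g).
Proof.
move=> g; apply: (@continuous_comp _ _ _ (fun g => (k, g))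
  (fun p : G * G => (p.1 * p.2)%g)); last exact: mulg_continuous.
by apply: cvg_pair; [exact: cvg_cst|exact: cvg_id].
Qed.

Lemma continuous_rmul k : continuous (fun g : G => (g * k)%g).
Proof.
move=> g; apply: (@continuous_comp _ _ _ (fun g => (g, k))
  (fun p : G * G => (p.1 * p.2)%g)); last exact: mulg_continuous.
by apply: cvg_pair; [exact: cvg_id|exact: cvg_cst].
Qed.

Lemma continuous_orbit x : continuous (fun g => lcoset_act g x).
Proof.
move=> g; apply: (@continuous_comp _ _ _ (fun g => (g * repr x)%g)
  (\pi_(lcosets K))%qT); first exact: continuous_rmul.
exact: pi_continuous.
Qed.

Lemma lcoset_actM g h x : lcoset_act (g * h)%g x = lcoset_act g (lcoset_act h x).
Proof.
rewrite /lcoset_act; set y := (h * repr x)%g.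
have : (\pi_(lcosets K) (repr (\pi_(lcosets K) y : lcosets K)) =
        \pi_(lcosets K) y)%qT by rewrite reprK.
move=> /eqmodP/=; rewrite /lcoset_rel => ry.
apply/eqmodP => /=; rewrite /lcoset_rel.
rewrite -mulgA -/y invgM mulgA -[((_ * _) * g)%g]mulgA mulVg mulg1.
by rewrite -gpredV invgM invgK.
Qed.

Lemma lcoset_act_transitive x y : exists g, lcoset_act g x = y.
Proof.
exists (repr y * (repr x)^-1)%g.
by rewrite /lcoset_act -mulgA mulVg mulg1 reprK.
Qed.

End HomogeneousSpace.

Section MatrixCoefficients.
Context (R : realType) (G : topologicalGroupType) (S : unitary_module R G).
Implicit Types (u v : S) (g h : G).

Lemma cauchy_schwarz u v : sqmod (um_form S u v) <=
  complex.Re (um_form S u u) * complex.Re (um_form S v v).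
Proof.
have sq z : (sqmod z)%:C = `|z| ^+ 2 :> R[i] by exact: add_Re2_Im2.
have reE w : um_form S w w = (complex.Re (um_form S w w))%:C.
  have := dnorm_ge0 (um_form S) w; case: (um_form S w w) => a b.
  by rewrite lecE => /andP[/eqP/= ->].
rewrite -lecR rmorphM/= -!reE sq.
by have /leifP := CauchySchwarz (um_form S) u v; case: ifP => _ => [/eqP ->|/ltW].
Qed.

(** The inverse comes from the Fourier transform, and it turns the action on
    [u] into a left translation of the argument. *)
Definition matrix_coef u v (g : G) : R[i] := um_form S (um_act S g^-1%g u) v.

Lemma matrix_coef_bounded u v g : sqmod (matrix_coef u v g) <=
  complex.Re (um_form S u u) * complex.Re (um_form S v v).
Proof. by rewrite (le_trans (cauchy_schwarz _ _))// um_unitary. Qed.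

Lemma matrix_coef_translate u v h g :
  matrix_coef (um_act S h u) v g = matrix_coef u v (h^-1 * g)%g.
Proof. by rewrite /matrix_coef -comp_lfunE -um_actM invgM invgK. Qed.

(** Strong continuity controls the coefficients through Cauchy-Schwarz; [p]
    stands for the real and for the imaginary part. *)
Lemma continuous_form_act u v (p : R[i] -> R) :
  (forall z w, p (z - w) = p z - p w) -> (forall z, p z ^+ 2 <= sqmod z) ->
  continuous (fun g => p (um_form S (um_act S g u) v)).
Proof.
move=> pB psq g0; apply/cvgrPdist_lt => e e0.
set c := complex.Re (um_form S v v).
have c0 : 0 <= c.
  by have := dnorm_ge0 (um_form S) v; rewrite lecE => /andP[].
(* [c + 1] because [c] may vanish *)
have e2 : 0 < e ^+ 2 / (c + 1) by rewrite divr_gt0 ?exprn_gt0// ltr_wpDl.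
have /cvgrPdist_lt/(_ _ e2) := um_continuous u g0.
apply: filterS => g /=; rewrite sub0r normrN => dlt.
have dlt' := le_lt_trans (ler_norm _) dlt.
rewrite -pB -[ltRHS]gtr0_norm// -ltr_sqr ?nnegrE// !real_normK ?num_real//.
apply: le_lt_trans (psq _) _.
rewrite -linearBl/=; apply: le_lt_trans (cauchy_schwarz _ _) _.
rewrite -/c -opprB linearNl linearNr opprK.
move: dlt'; rewrite ltr_pdivlMr ?ltr_wpDl//; apply: le_lt_trans.
rewrite ler_wpM2l ?lerDl//.
have := dnorm_ge0 (um_form S) (um_act S g u - um_act S g0 u).
by rewrite lecE => /andP[].
Qed.

Lemma cmeasurable_matrix_coef u v :
  cmeasurable (matrix_coef u v : borel G -> R[i]).
Proof.
have cinv (f : G -> R) : continuous f -> continuous (fun g => f g^-1%g).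
  by move=> cf g; apply: continuous_comp; [exact: invg_continuous|exact: cf].
apply/cmeasurableP; split; apply: continuous_borel_real.
  apply: (cinv (fun g => complex.Re (um_form S (um_act S g u) v))).
  apply: continuous_form_act => [[a b] [c d]//|z].
  by rewrite lerDl sqr_ge0.
apply: (cinv (fun g => complex.Im (um_form S (um_act S g u) v))).
apply: continuous_form_act => [[a b] [c d]//|z].
by rewrite lerDr sqr_ge0.
Qed.

Lemma bounded_matrix_coef u v :
  bounded_multiplier (matrix_coef u v : borel G -> R[i]).
Proof.
split; first exact: cmeasurable_matrix_coef.
by eexists => g; exact: matrix_coef_bounded.
Qed.

End MatrixCoefficients.

Section BoundedMultipliers.
Context (R : realType) d (X : measurableType d).
Implicit Types a b : X -> R[i].

Lemma bounded_multiplierZ k a :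
  bounded_multiplier a -> bounded_multiplier (fun x => k * a x).
Proof.
move=> [ma [M aM]]; split.
  by apply: cmeasurableM => //; exact: cmeasurable_cst.
exists (sqmod k * M) => x.
by rewrite sqmodM ler_wpM2l// sqmod_ge0.
Qed.

Lemma bounded_multiplier_sum (I : Type) (s : seq I) (h : I -> X -> R[i]) :
  (forall i, bounded_multiplier (h i)) ->
  bounded_multiplier (fun x => \sum_(i <- s) h i x).
Proof.
move=> bh; split; first by apply: cmeasurable_sum => i; case: (bh i).
elim: s => [|i s [M IH]].
  by exists 0 => x; rewrite big_nil /sqmod/= expr0n addr0.
have [_ [N iN]] := bh i; exists (2 * N + 2 * M) => x; rewrite big_cons.
apply: le_trans (sqmodD_le _ _) _.
by apply: lerD; rewrite ler_pM2l.
Qed.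

End BoundedMultipliers.

(** * Fourier coefficients of invariant fields *)

Section InvariantFields.
Context (R : realType) (G : topologicalGroupType) (K : groupClosed G).
Context (dg : probability (borel G) R) (haar_dg : is_haar dg).
Context (dx : probability (borel (lcosets K)) R) (x0 : lcosets K).
Context d (W : measurableType d) (P : probability W R).
Context (T : lcosets K -> W -> R[i]).
Hypothesis fieldT : random_field T.
Hypothesis invT : invariant_field P T.
Hypothesis varT : finite_variance P dx T.

Let mT : cmeasurable (fun p : borel (lcosets K) * W => T p.1 p.2).
Proof. exact: fieldT. Qed.

Lemma field_cmeasurable x : cmeasurable (T x).
Proof.
exact: (cmeasurable_comp (h := fun w => (x : borel (lcosets K), w))
  (measurable_pair1 (x : borel (lcosets K))) mT).
Qed.

(** The invariant laws of one and of two values of the field determine its mean,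
    its variance and its covariance kernel. *)
Lemma measurable_field_tuple m (x : 'I_m -> lcosets K) :
  measurable_fun setT (fun w => [tuple reim (T (x i) w) | i < m]).
Proof.
apply/measurable_fun_tnthP => i.
rewrite (_ : _ \o _ = @reim R \o T (x i)); first exact: field_cmeasurable.
by apply/funext => w /=; rewrite tnth_mktuple.
Qed.

Let cmeasurable_tnth m (i : 'I_m) :
  cmeasurable (fun t : m.-tuple (R * R) => (tnth t i).1 +i* (tnth t i).2).
Proof.
apply/cmeasurableP; split => /=.
  exact: (measurableT_comp measurable_fst (measurable_tnth i)).
exact: (measurableT_comp measurable_snd (measurable_tnth i)).
Qed.

Let reimK (z : R[i]) : (reim z).1 +i* (reim z).2 = z.
Proof. by case: z. Qed.

Lemma invariant_expect g x : expect P (T (lcoset_act g x)) = expect P (T x).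
Proof.
pose xs (i : 'I_1) := x.
pose f (t : 1.-tuple (R * R)) : R[i] := (tnth t ord0).1 +i* (tnth t ord0).2.
have /esym := cintegral_eq_law (measurable_field_tuple xs)
  (measurable_field_tuple (fun i => lcoset_act g (xs i)))
  (invT g xs) (cmeasurable_tnth ord0 : cmeasurable f).
have E (z : 'I_1 -> lcosets K) :
    cintegral P (fun w => f [tuple reim (T (z i) w) | i < 1]) =
    expect P (T (z ord0)).
  by apply: eq_cintegral => w; rewrite /f !tnth_mktuple reimK.
by rewrite !E.
Qed.

Lemma invariant_expectM g x y :
  expect P (fun w => T (lcoset_act g x) w * (T (lcoset_act g y) w)^*) =
  expect P (fun w => T x w * (T y w)^*).
Proof.
pose xs (i : 'I_2) := if i == ord0 then x else y.
pose f (t : 2.-tuple (R * R)) : R[i] :=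
  ((tnth t ord0).1 +i* (tnth t ord0).2) *
  ((tnth t (lift ord0 ord0)).1 +i* (tnth t (lift ord0 ord0)).2)^*.
have mf : cmeasurable f.
  apply: cmeasurableM; first exact: cmeasurable_tnth.
  by apply: cmeasurableJ; exact: cmeasurable_tnth.
have /esym := cintegral_eq_law (measurable_field_tuple xs)
  (measurable_field_tuple (fun i => lcoset_act g (xs i))) (invT g xs) mf.
have E (z : 'I_2 -> lcosets K) :
    cintegral P (fun w => f [tuple reim (T (z i) w) | i < 2]) =
    expect P (fun w => T (z ord0) w * (T (z (lift ord0 ord0)) w)^*).
  by apply: eq_cintegral => w; rewrite /f !tnth_mktuple !reimK.
by rewrite !E.
Qed.

Lemma invariant_second_moment g x :
  (\int[P]_w (sqmod (T (lcoset_act g x) w))%:E =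
   \int[P]_w (sqmod (T x w))%:E)%E.
Proof.
pose xs (i : 'I_1) := x.
pose f (t : 1.-tuple (R * R)) :=
  (sqmod ((tnth t ord0).1 +i* (tnth t ord0).2))%:E.
have mf : measurable_fun setT f.
  by have := measurable_sqmod (@cmeasurable_tnth 1 ord0) => /measurable_EFinP.
have f0 t : (0 <= f t)%E by rewrite lee_fin sqmod_ge0.
have /esym := ge0_integral_eq_law (measurable_field_tuple xs)
  (measurable_field_tuple (fun i => lcoset_act g (xs i))) (invT g xs) mf f0.
have E (z : 'I_1 -> lcosets K) :
    (\int[P]_w f [tuple reim (T (z i) w) | i < 1] =
     \int[P]_w (sqmod (T (z ord0) w))%:E)%E.
  by apply: eq_integral => w _; rewrite /f !tnth_mktuple reimK.
by rewrite !E.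
Qed.

(** By transitivity all the points have the same second moment, so that
    the variance integrated over the probability [dx] is this common value;
    comparing [dx] with the image of the Haar measure is thereby avoided. *)
Lemma second_moment_bounded :
  exists c : R, forall x, (\int[P]_w (sqmod (T x w))%:E <= c%:E)%E.
Proof.
pose m2 := (\int[P]_w (sqmod (T x0 w))%:E)%E.
have cst_m2 x : (\int[P]_w (sqmod (T x w))%:E = m2)%E.
  have [g <-] := lcoset_act_transitive x0 x.
  exact: invariant_second_moment.
have m20 : (0 <= m2)%E by apply: integral_ge0 => w _; rewrite lee_fin sqmod_ge0.
suff m2oo : (m2 < +oo)%E.
  by exists (fine m2) => x; rewrite cst_m2 fineK// ge0_fin_numE.
have mT2 : measurable_fun [set: borel (lcosets K) * W]
    (fun p => (sqmod (T p.1 p.2))%:E).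
  by have := measurable_sqmod mT => /measurable_EFinP.
have T0 (p : borel (lcosets K) * W) : (0 <= (sqmod (T p.1 p.2))%:E)%E.
  by rewrite lee_fin sqmod_ge0.
move: varT; rewrite /finite_variance.
have /= <- := @fubini_tonelli _ _ _ _ _ dx P _ mT2 T0.
under eq_integral do rewrite cst_m2.
rewrite integral_cst// [X in (_ * X)%E](_ : _ = 1%E) ?mule1//.
exact: probability_setT.
Qed.

Definition lifted_field (g : borel G) (w : W) : R[i] :=
  T (lcoset_act (g : G) x0) w.

Lemma cmeasurable_lifted_field :
  cmeasurable (fun p : borel G * W => lifted_field p.1 p.2).
Proof.
have mo := continuous_borel (@continuous_orbit _ K x0).
apply: (cmeasurable_comp (h := fun p : borel G * W =>
  (lcoset_act (p.1 : G) x0 : borel (lcosets K), p.2)) _ mT).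
apply: measurable_fun_pair => //.
exact: (measurableT_comp mo measurable_fst).
Qed.

Let ms k : measurable_fun [set: borel G]
  ((fun g : G => (k * g)%g) : borel G -> borel G).
Proof. exact: continuous_borel (@continuous_lmul _ k). Qed.

Let mus k : forall A : set (borel G), measurable A ->
  dg ((fun g : G => (k * g)%g) @^-1` A) = dg A.
Proof. by move=> A; exact: haar_dg.2. Qed.

Section Coefficients.
Context (S : unitary_module R G).
Implicit Types (u v : S).

(** The multiplier against which the lifted field is averaged to produce
    [<That u, v>]. *)
Definition fourier_multiplier u v (g : borel G) : R[i] :=
  (Num.sqrt ((um_dim S)%:R : R))%:C * matrix_coef u v (g : G).

Lemma bounded_fourier_multiplier u v : bounded_multiplier (fourier_multiplier u v).
Proof. exact/bounded_multiplierZ/bounded_matrix_coef. Qed.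

Lemma fourier_multiplier_translate u v (h : G) :
  fourier_multiplier (um_act S h u) v =
  fourier_multiplier u v \o (fun g : G => (h^-1 * g)%g).
Proof. by apply/funext => g; rewrite /fourier_multiplier matrix_coef_translate. Qed.

Context (e : (um_dim S).-tuple S) (onb_e : orthonormal_basis e).

Lemma bounded_functional_act (f : {scalar 'End(S)}) :
  bounded_multiplier (fun g : borel G => f (um_act S (g : G)^-1%g)).
Proof.
have [c fE] := functional_entries onb_e f.
under eq_fun do rewrite fE.
apply: bounded_multiplier_sum => i; apply: bounded_multiplier_sum => j.
exact/bounded_multiplierZ/bounded_matrix_coef.
Qed.

(** Where the sample path is not square integrable the coordinatewise integral
    is still a linear combination of averages against bounded multipliers, so
    measurability and integrability do not depend on such exceptional paths. *)
Lemma square_integrable_fourier u v :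
  square_integrable P (fun w => um_form S (fourier dg x0 T S w u) v).
Proof.
have [c Tc] := second_moment_bounded.
have Yc (g : borel G) := Tc (lcoset_act (g : G) x0).
have [f fE] := form_functional u v.
have -> : (fun w => um_form S (fourier dg x0 T S w u) v) = (fun w =>
    (Num.sqrt ((um_dim S)%:R : R))%:C *
    \sum_(m < \dim (fullv : {vspace 'End(S)}))
      f (vbasis fullv)`_m * mean_against dg lifted_field
        (fun g : borel G => coord (vbasis fullv) m (um_act S (g : G)^-1%g)) w).
  apply/funext => w.
  rewrite -fE /fourier linearZ/=; congr (_ * _).
  rewrite /vintegral linear_sum/=; apply: eq_bigr => m _.
  rewrite linearZ/= mulrC; congr (_ * _).
  by apply: eq_cintegral => g; rewrite linearZ.
apply: square_integrableZl; apply: square_integrable_sum => m.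
apply: square_integrableZl.
apply: (square_integrable_mean dg cmeasurable_lifted_field Yc).
exact: bounded_functional_act.
Qed.

(** On a square integrable sample path every coordinate is integrable, so that
    the functional may be moved inside the coordinatewise integral. *)
Lemma fourier_mean u v w : square_integrable dg (lifted_field ^~ w) ->
  um_form S (fourier dg x0 T S w u) v =
  mean_against dg lifted_field (fourier_multiplier u v) w.
Proof.
move=> w2; have [f fE] := form_functional u v.
have ib a : bounded_multiplier a ->
    cintegrable dg (fun g => lifted_field g w * a g).
  by move=> ba; exact: (cintegrable_multiplier ba w2).
rewrite -fE /fourier linearZ/=.
rewrite vintegral_functional; last first.
  move=> m; have := ib _ (bounded_functional_act (coord (vbasis fullv) m)).
  by apply: cintegrable_ext => g; rewrite linearZ.
rewrite -cintegralZl.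
  by apply: eq_cintegral => g; rewrite linearZ/= fE /fourier_multiplier [RHS]mulrCA.
have := ib _ (bounded_matrix_coef u v).
by apply: cintegrable_ext => g; rewrite linearZ/= fE.
Qed.

Lemma ae_fourier_mean u v : {ae P, forall w,
  um_form S (fourier dg x0 T S w u) v =
  mean_against dg lifted_field (fourier_multiplier u v) w}.
Proof.
have [c Tc] := second_moment_bounded.
have Yc (g : borel G) := Tc (lcoset_act (g : G) x0).
have := ae_square_integrable dg cmeasurable_lifted_field Yc.
by apply: filterS => w; exact: fourier_mean.
Qed.

Lemma expect_fourier u v :
  expect P (fun w => um_form S (fourier dg x0 T S w u) v) =
  expect P (mean_against dg lifted_field (fourier_multiplier u v)).
Proof.
have [c Tc] := second_moment_bounded.
have Yc (g : borel G) := Tc (lcoset_act (g : G) x0).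
apply: ae_eq_cintegral (ae_fourier_mean u v).
  by case: (square_integrable_fourier u v).
by case: (square_integrable_mean dg cmeasurable_lifted_field Yc
  (bounded_fourier_multiplier u v)).
Qed.

Lemma expect_fourier_act h u v :
  expect P (fun w => um_form S (fourier dg x0 T S w (um_act S h u)) v) =
  expect P (fun w => um_form S (fourier dg x0 T S w u) v).
Proof.
have [c Tc] := second_moment_bounded.
have Yc (g : borel G) := Tc (lcoset_act (g : G) x0).
rewrite !expect_fourier fourier_multiplier_translate.
apply: (expect_mean_translate cmeasurable_lifted_field Yc (ms _) (mus _)).
  exact: bounded_fourier_multiplier.
by move=> g; rewrite /lifted_field lcoset_actM; exact: invariant_expect.
Qed.

Lemma expect_fourier_centered u v : (forall x, expect P (T x) = 0) ->
  expect P (fun w => um_form S (fourier dg x0 T S w u) v) = 0.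
Proof.
have [c Tc] := second_moment_bounded.
have Yc (g : borel G) := Tc (lcoset_act (g : G) x0).
move=> T0; rewrite expect_fourier.
rewrite (expect_mean dg cmeasurable_lifted_field Yc (bounded_fourier_multiplier u v)).
rewrite -[RHS](cintegral0 dg); apply: eq_cintegral => g.
by rewrite T0 mulr0.
Qed.

End Coefficients.

Section Pairing.
Context (S1 S2 : unitary_module R G).
Context (e1 : (um_dim S1).-tuple S1) (onb_e1 : orthonormal_basis e1).
Context (e2 : (um_dim S2).-tuple S2) (onb_e2 : orthonormal_basis e2).
Context (a : S1) (b : S2).

(** The second moments of row [a] of one coefficient against row [b] of the
    other, as a sesquilinear form in the columns. *)
Definition fourier_pairing (u : S1) (v : S2) : R[i] :=
  expect P (fun w => um_form S1 (fourier dg x0 T S1 w u) a *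
                     (um_form S2 (fourier dg x0 T S2 w v) b)^*).

Let ifourier u v :
  cintegrable P (fun w => um_form S1 (fourier dg x0 T S1 w u) a *
                          (um_form S2 (fourier dg x0 T S2 w v) b)^*).
Proof.
apply: square_integrableM; first exact: square_integrable_fourier onb_e1 u a.
exact/square_integrableJ/(square_integrable_fourier onb_e2 v b).
Qed.

Lemma fourier_pairing_linear v k u u' : fourier_pairing (k *: u + u') v =
  k * fourier_pairing u v + fourier_pairing u' v.
Proof.
rewrite /fourier_pairing /expect -cintegralZl// -cintegralD//;
  last exact: cintegrableZl.
by apply: eq_cintegral => w; rewrite linearP linearDl linearZl_LR/= mulrDl mulrA.
Qed.

Lemma fourier_pairing_semilinear u k v v' : fourier_pairing u (k *: v + v') =
  k^* * fourier_pairing u v + fourier_pairing u v'.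
Proof.
rewrite /fourier_pairing /expect -cintegralZl// -cintegralD//;
  last exact: cintegrableZl.
apply: eq_cintegral => w.
by rewrite linearP linearDl linearZl_LR/= rmorphD rmorphM/= mulrDr mulrCA.
Qed.

Lemma fourier_pairingE u v : fourier_pairing u v = expect P (fun w =>
  mean_against dg lifted_field (fourier_multiplier u a) w *
  (mean_against dg lifted_field (fourier_multiplier v b) w)^*).
Proof.
have [c Tc] := second_moment_bounded.
have Yc (g : borel G) := Tc (lcoset_act (g : G) x0).
have [m1 _] := square_integrable_mean dg cmeasurable_lifted_field Yc
  (bounded_fourier_multiplier u a).
have [m2 _] := square_integrable_mean dg cmeasurable_lifted_field Yc
  (bounded_fourier_multiplier v b).
apply: ae_eq_cintegral.
- exact: cintegrable_measurable (ifourier u v).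
- exact/cmeasurableM/cmeasurableJ.
- by apply: filterS2 (ae_fourier_mean onb_e1 u a) (ae_fourier_mean onb_e2 v b)
    => w -> ->.
Qed.

(** Replacing [u] by [g u] translates the multiplier, and a simultaneous
    translation is absorbed by the invariance of the field. *)
Lemma fourier_pairing_invariant g u v :
  fourier_pairing (um_act S1 g u) (um_act S2 g v) = fourier_pairing u v.
Proof.
have [c Tc] := second_moment_bounded.
have Yc (h : borel G) := Tc (lcoset_act (h : G) x0).
rewrite !fourier_pairingE !fourier_multiplier_translate.
apply: (expect_mean_pair_translate cmeasurable_lifted_field Yc (ms _) (mus _)).
- exact: bounded_fourier_multiplier.
- exact: bounded_fourier_multiplier.
- by move=> h k; rewrite /covkernel /lifted_field !lcoset_actM; exact: invariant_expectM.
Qed.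

End Pairing.

(** The mean of a row of the coefficient is an invariant functional of the
    column vector. *)
Lemma expect_fourier_nontrivial (S : unitary_module R G)
    (e : (um_dim S).-tuple S) : orthonormal_basis e -> um_irreducible S ->
  ~ um_trivial S ->
  forall u v, expect P (fun w => um_form S (fourier dg x0 T S w u) v) = 0.
Proof.
move=> onb_e irrS ntriv u v; move: u.
apply: (invariant_functional0 onb_e irrS ntriv) => [k u u'|g u].
  have int z := square_integrable_cintegrable (square_integrable_fourier onb_e z v).
  rewrite /expect -cintegralZl// -cintegralD//; last exact: cintegrableZl.
  by apply: eq_cintegral => w; rewrite linearP linearDl linearZl_LR.
exact: (expect_fourier_act onb_e).
Qed.

Lemma entry_fourier_Gamma (S : unitary_module R G) (e : (um_dim S).-tuple S)
    (onb_e : orthonormal_basis e) i k :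
  entry e (fourier_Gamma P dg x0 T S) i k =
  \sum_m fourier_pairing (tnth e i) (tnth e k) (tnth e m) (tnth e m).
Proof.
pose F w := fourier dg x0 T S w.
have entryF w j l : entry e (F w \o adjoint (F w))%VF j l =
    \sum_m um_form S (F w (tnth e m)) (tnth e j) *
      (um_form S (F w (tnth e m)) (tnth e l))^*.
  rewrite (entry_comp onb_e); apply: eq_bigr => m _.
  by rewrite (entry_adjoint onb_e).
have intF j l m : cintegrable P (fun w => um_form S (F w (tnth e m)) (tnth e j) *
      (um_form S (F w (tnth e m)) (tnth e l))^*).
  apply: square_integrableM; first exact: square_integrable_fourier onb_e _ _.
  exact/square_integrableJ/(square_integrable_fourier onb_e).
have intE j l : cintegrable P (fun w => entry e (F w \o adjoint (F w))%VF j l).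
  by under eq_fun do rewrite entryF; exact: cintegrable_sum.
have [f fE] := form_functional (tnth e k) (tnth e i).
rewrite /entry -fE vintegral_functional; last first.
  move=> m; have [c cE] := functional_entries onb_e (coord (vbasis fullv) m).
  under eq_fun do rewrite cE.
  by apply: cintegrable_sum => j; apply: cintegrable_sum => l; exact: cintegrableZl.
rewrite -(cintegral_sum _ (fun m => intF i k m)).
by apply: eq_cintegral => w; rewrite fE -[LHS]/(entry e _ i k) entryF.
Qed.

End InvariantFields.

Theorem theorem3p2 (R : realType)
    (G : topologicalGroupType) (cptG : compact [set: G])
    (hausG : hausdorff_space G)
    (K : groupClosed G) (closedK : closed [set g : G | g \in K])
    (dg : probability (borel G) R) (haar_dg : is_haar dg)
    (dx : probability (borel (lcosets K)) R) (inv_dx : is_invariant dx)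
    (x0 : lcosets K) (isotropy_x0 : forall g : G, lcoset_act g x0 = x0 <-> g \in K)
    (d : measure_display) (W : measurableType d) (P : probability W R)
    (T : lcosets K -> W -> R[i])
    (fieldT : random_field T) (invT : invariant_field P T)
    (varT : finite_variance P dx T) :
  (forall S1 S2 : unitary_module R G,
     um_irreducible S1 -> um_irreducible S2 -> ~ um_equivalent S1 S2 ->
     forall (e1 : (um_dim S1).-tuple S1) (e2 : (um_dim S2).-tuple S2),
     orthonormal_basis e1 -> orthonormal_basis e2 ->
     forall (i j : 'I_(um_dim S1)) (k l : 'I_(um_dim S2)),
       orthogonal_rv P
         (fun w => entry e1 (fourier dg x0 T S1 w) i j)
         (fun w => entry e2 (fourier dg x0 T S2 w) k l))
  /\
  (forall S : unitary_module R G, um_irreducible S ->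
     forall e : (um_dim S).-tuple S, orthonormal_basis e ->
     let That i j := fun w => entry e (fourier dg x0 T S w) i j in
     let Gamma i k := entry e (fourier_Gamma P dg x0 T S) i k in
     [/\ forall i j, square_integrable P (That i j),
         forall i j k l,
           expect P (fun w => That i j w * (That k l w)^*) =
           (j == l)%:R * Gamma i k / (um_dim S)%:R,
         ~ um_trivial S \/ (forall x, expect P (T x) = 0) ->
           forall i j k l,
             cov P (That i j) (That k l) = (j == l)%:R * Gamma i k / (um_dim S)%:R,
         forall i j k l, j != l -> orthogonal_rv P (That i j) (That k l) &
         forall i k j j', i != k ->
           cov P (That i j) (That k j) = cov P (That i j') (That k j')]).
Proof.
have s2 (S : unitary_module R G) e : @orthonormal_basis R G S e -> forall i j,
    square_integrable P (fun w => entry e (fourier dg x0 T S w) i j).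
  by move=> onb_e i j; exact: (square_integrable_fourier dg x0 fieldT invT varT onb_e).
split=> [S1 S2 irr1 irr2 neq e1 e2 onb1 onb2 i j k l|S irrS e onb_e].
  split; [exact: s2|exact: s2|].
  rewrite -[LHS]/(fourier_pairing dg x0 P T (tnth e1 i) (tnth e2 k)
                                  (tnth e1 j) (tnth e2 l)).
  apply: (invariant_pairing0 onb2 irr1 irr2 neq).
  - exact: (fourier_pairing_linear dg x0 fieldT invT varT onb1 onb2).
  - exact: (fourier_pairing_semilinear dg x0 fieldT invT varT onb1 onb2).
  - exact: (fourier_pairing_invariant haar_dg x0 fieldT invT varT onb1 onb2).
move=> That Gamma.
have dim0 : (um_dim S)%:R != 0 :> R[i].
  by rewrite pnatr_eq0 -lt0n; case: irrS.
have second_moments i j k l : expect P (fun w => That i j w * (That k l w)^*) =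
    (j == l)%:R * Gamma i k / (um_dim S)%:R.
  have [c cE] := invariant_pairing_scalar onb_e irrS
    (fourier_pairing_linear dg x0 fieldT invT varT onb_e onb_e
       (tnth e i) (tnth e k))
    (fourier_pairing_semilinear dg x0 fieldT invT varT onb_e onb_e
       (tnth e i) (tnth e k))
    (fourier_pairing_invariant haar_dg x0 fieldT invT varT onb_e onb_e
       (tnth e i) (tnth e k)).
  rewrite [LHS]cE (onb_form onb_e) /Gamma.
  rewrite (entry_fourier_Gamma dg x0 fieldT invT varT onb_e).
  under eq_bigr do rewrite cE (onb_form onb_e) eqxx mulr1.
  by rewrite sumr_const card_ord -[c *+ _]mulr_natr mulrA mulfK// mulrC.
have covE : ~ um_trivial S \/ (forall x, expect P (T x) = 0) ->
    forall i j k l,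
    cov P (That i j) (That k l) = (j == l)%:R * Gamma i k / (um_dim S)%:R.
  move=> centered i j k l.
  have E0 i' j' : expect P (That i' j') = 0.
    case: centered => [ntriv|T0].
      exact: (expect_fourier_nontrivial haar_dg x0 fieldT invT varT onb_e irrS ntriv).
    exact: (expect_fourier_centered dg x0 fieldT invT varT onb_e _ _ T0).
  rewrite /cov !E0 -second_moments.
  by apply: eq_cintegral => w; rewrite !subr0.
split; [exact: s2|exact: second_moments|exact: covE| |].
- move=> i j k l jl; split; [exact: s2|exact: s2|].
  by rewrite second_moments (negbTE jl) !mul0r.
- move=> i k j j' ik; have [triv|ntriv] := pselect (um_trivial S).
    (* a trivial irreducible module has a single row *)
    have d1 := trivial_irreducible_dim1 irrS triv.
    case/eqP: ik; apply: val_inj => /=.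
    have row0 (r : 'I_(um_dim S)) : r = 0%N :> nat.
      by apply/eqP; rewrite -leqn0 -ltnS -d1 ltn_ord.
    by rewrite !row0.
  by rewrite !covE ?eqxx//; left.
Qed.
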